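(* Let $\alpha,\eta,\nu\in(0,1)$ be constants. Given a Label Cover instance $\mathcal{L}=(U_{\mathcal L},V_{\mathcal L},E_{\mathcal L},[k],[s],\{\pi_{v\to u}\}_{(u,v)\in E_{\mathcal L}})$, there exists an efficient procedure (depending on $\eta$) which outputs a $4$-Lin instance $H=(V_H,E_H)$ such that: (1) if $\mathcal{L}$ is $1$-satisfiable (i.e. $\mathsf{Val}(\mathcal L)=1$), then there exists an assignment $\sigma:V_H\to\{0,1\}$ which satisfies at least a $(1-2\eta)$-fraction of the constraints in $H$; (2) if there exists a subset $S\subseteq V_H$ of size at least $\alpha|V_H|$ and an assignment $\sigma:S\to\{0,1\}$ which satisfies at least a $(1/2+\nu)$-fraction of the constraints of $E_H$ all of whose variables lie in $S$, then $\mathsf{Val}(\mathcal L)\ge\Omega(\nu\alpha^{16}\eta^2)$.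
   Context: A (bipartite) Label Cover instance $\mathcal{L}(U_{\mathcal L},V_{\mathcal L},E_{\mathcal L},[k],[s],\{\pi_e\})$ consists of a bi-regular bipartite (multi)graph with sides $U_{\mathcal L},V_{\mathcal L}$ and edge multiset $E_{\mathcal L}$, where each edge $e=(u,v)$ carries a projection $\pi_{v\to u}:[k]\to[s]$; labels of $U_{\mathcal L}$ come from $[s]$ and of $V_{\mathcal L}$ from $[k]$, and a labeling satisfies $(u,v)$ if $\pi_{v\to u}(\text{label of }v)=\text{label of }u$. $\mathsf{Val}(\mathcal L)$ is the maximum fraction of constraints satisfiable by a labeling. A $4$-Lin instance $H=(V_H,E_H)$ has variable set $V_H$ taking values in $\mathbb{F}_2$ and a (multi)set $E_H$ of linear equations over $\mathbb{F}_2$, each on $4$ variables. *)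

(* Defs.v *)
From mathcomp Require Import all_boot all_order all_algebra.
From mathcomp Require Import reals.

Set Implicit Arguments.
Unset Strict Implicit.
Unset Printing Implicit Defensive.

Import Order.TTheory GRing.Theory Num.Theory.
Local Open Scope ring_scope.

(* An edge is (u, v, pi) with pi = pi_{v -> u}; the edge multiset is a list,
   so parallel edges may carry different projections. *)
Definition lc_edge (nU nV k s : nat) : Type :=
  ('I_nU * 'I_nV * {ffun 'I_k -> 'I_s})%type.

Record label_cover (k s : nat) := LabelCover {
  lcU : nat;
  lcV : nat;
  lcE : seq (lc_edge lcU lcV k s);
  lc_labels : (0 < k)%N;
  lc_nonempty : (0 < size lcE)%N;
  lc_regU : exists d, forall u, count (fun e => e.1.1 == u) lcE = d;
  lc_regV : exists d, forall v, count (fun e => e.1.2 == v) lcE = d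
}.

Definition labeling k s (L : label_cover k s) : Type :=
  ({ffun 'I_(lcU L) -> 'I_s} * {ffun 'I_(lcV L) -> 'I_k})%type.

Definition lc_sat k s (L : label_cover k s) (l : labeling L)
    (e : lc_edge (lcU L) (lcV L) k s) : bool :=
  e.2 (l.2 e.1.2) == l.1 e.1.1.

Definition Val (R : realType) k s (L : label_cover k s) : R :=
  (\max_(l : labeling L) count (lc_sat l) (lcE L))%:R / (size (lcE L))%:R.

(* (t, b) stands for the equation sum of the variables in t = b. *)
Definition lin_eqn (n : nat) : Type := (4.-tuple 'I_n * 'F_2)%type.

Record lin4 := Lin4 {
  lin_nvar : nat;
  lin_eqs : seq (lin_eqn lin_nvar);
  lin_distinct : all (fun e : lin_eqn lin_nvar => uniq e.1) lin_eqs
}.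

Definition lin_sat (H : lin4) (sigma : 'I_(lin_nvar H) -> 'F_2)
    (e : lin_eqn (lin_nvar H)) : bool :=
  \sum_(i <- e.1) sigma i == e.2.

Definition lin_induced (H : lin4) (S : {set 'I_(lin_nvar H)}) :
    seq (lin_eqn (lin_nvar H)) :=
  [seq e : lin_eqn (lin_nvar H) <- lin_eqs H | all (fun i => i \in S) e.1].

(* Model of computation: a first-order functional language over binary trees,
   with de Bruijn variables, whose only recursion is iteration over the right
   spine of a tree, read as a list.  Evaluating any expression is charged the
   full size of its value on top of the cost of evaluating its
   subexpressions, so that sharing cannot hide large intermediate values:
   a multitape Turing machine simulates a run in time polynomial in the input
   size plus the cost. *)
Inductive tree := Leaf | Node of tree & tree.

Fixpoint tsize (t : tree) : nat :=
  if t is Node l r then (tsize l + tsize r).+1 else 1%N.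

Inductive expr :=
  | EVar of nat
  | ELeaf
  | ENode of expr & expr
  | ELet of expr & expr           (* body sees: value, env *)
  | ECase of expr & expr & expr   (* Node branch sees: left, right, env *)
  | EFold of expr & expr & expr.  (* list, start; step sees: head, acc, env *)

Fixpoint tfoldl (A : Type) (f : tree -> A -> A) (l : tree) (a : A) : A :=
  if l is Node h t then tfoldl f t (f h a) else a.

Definition charge (vc : tree * nat) : tree * nat :=
  (vc.1, (tsize vc.1 + vc.2)%N).

(* exec env e = (value, cost) *)
Fixpoint exec (env : seq tree) (e : expr) : tree * nat :=
  charge match e with
  | EVar i => (nth Leaf env i, 0%N)
  | ELeaf => (Leaf, 0%N)
  | ENode a b =>
      let: (va, ca) := exec env a in
      let: (vb, cb) := exec env b in
      (Node va vb, (ca + cb)%N)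
  | ELet a b =>
      let: (va, ca) := exec env a in
      let: (vb, cb) := exec (va :: env) b in
      (vb, (ca + cb)%N)
  | ECase a b c =>
      let: (va, ca) := exec env a in
      let: (vr, cr) :=
        if va is Node h t then exec (h :: t :: env) c else exec env b in
      (vr, (ca + cr)%N)
  | EFold l a f =>
      let: (vl, cl) := exec env l in
      let: (va, ca) := exec env a in
      tfoldl (fun h acc =>
        let: (w, cw) := exec (h :: acc.1 :: env) f in (w, (acc.2 + cw)%N))
        vl (va, (cl + ca)%N)
  end.

Definition eval (P : expr) (x : tree) : tree := (exec [:: x] P).1.
Definition cost (P : expr) (x : tree) : nat := (exec [:: x] P).2.

(* Numbers are encoded in unary.  This changes the size of an instance only
   polynomially for fixed k and s: vertex indices and the vertex counts of a
   bi-regular nonempty instance are at most the number of edges. *)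
Definition enc_nat (n : nat) : tree := iter n (Node Leaf) Leaf.

Definition enc_seq (T : Type) (enc : T -> tree) (l : seq T) : tree :=
  foldr (fun x t => Node (enc x) t) Leaf l.

Definition enc_edge nU nV k s (e : lc_edge nU nV k s) : tree :=
  Node (enc_nat e.1.1)
    (Node (enc_nat e.1.2)
      (enc_seq (fun i => enc_nat (e.2 i)) (enum 'I_k))).

Definition enc_lc k s (L : label_cover k s) : tree :=
  Node (enc_nat (lcU L))
    (Node (enc_nat (lcV L))
      (Node (enc_nat k)
        (Node (enc_nat s) (enc_seq (@enc_edge _ _ k s) (lcE L))))).

Definition enc_eqn n (e : lin_eqn n) : tree :=
  Node (enc_seq (fun i : 'I_n => enc_nat i) e.1) (enc_nat (e.2 : nat)).

Definition enc_lin4 (H : lin4) : tree :=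
  Node (enc_nat (lin_nvar H)) (enc_seq (@enc_eqn _) (lin_eqs H)).

(* One program for all alphabets, running in polynomial time when the
   alphabet sizes k and s are constants. *)
Definition efficient (P : expr) : Prop :=
  forall k s : nat, exists C d : nat, forall L : label_cover k s,
    (cost P (enc_lc L) <= C * tsize (enc_lc L) ^ d)%N.

Definition outputs (P : expr) k s (L : label_cover k s) (H : lin4) : Prop :=
  eval P (enc_lc L) = enc_lin4 H.

(* Main.v *)
(* The reduction composes a 4-query dictatorship test with Label Cover.  A
   variable is a triple (v, x, c) with v in V, x in {0,1}^k and c in [s] a copy
   index; writing f_v for (-1)^sigma on the cloud of v, an equation reads
     f_v(x, c1) f_v(x + z o pi + mu + b, c2) f_v'(y, c3) f_v'(y + z o pi' + mu', c4) = (-1)^b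
   for edges (u, v), (u, v') with projections pi, pi', a common z in {0,1}^s,
   noise mu, mu' flipping every bit with probability 1/q, and pairwise distinct
   copies.  A dictator assignment only fails because of the noise.

   Conversely, with f supported on S and averaged over the copies, the Fourier
   expansion of the signed test is a nonnegative combination of
   f^_v(a)^2 f^_v'(a')^2 (1 - 2/q)^(|a|+|a'|), in which the sign (-1)^b kills even
   |a| and z kills the pairs a, a' without i in a, i' in a' such that
   pi i = pi' i'.  Choosing a label in a with probability f^_v(a)^2 / |a| thus
   satisfies a 1/q^2-proportional fraction of the edges.  Without signs, the
   empty frequencies alone show that S spans at least an alpha^4 fraction of the
   equations.  The copies make the four variables distinct; the equations lost to
   collisions are an O(1/s) fraction, and Val >= 1/s absorbs them.

   For the running time, everything that depends only on k, s, q and the two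
   projections ranges over finitely many inputs, hence costs a constant; only the
   loops over pairs of edges and the unary arithmetic on vertices are estimated. *)
Require Import Defs.
From mathcomp Require Import all_boot all_order all_algebra.
From mathcomp Require Import reals.
From mathcomp Require Import zify ring lra.

Set Implicit Arguments.
Unset Strict Implicit.
Unset Printing Implicit Defensive.

Import Order.TTheory GRing.Theory Num.Theory.

(* [tuple] also exports a [tsize]. *)
Local Notation tsize := Defs.tsize.

(** * Evaluation and cost *)

(** The value half of [exec], so that correctness is proved without carrying costs along. *)
Fixpoint ev (env : seq tree) (e : expr) : tree :=
  match e with
  | EVar i => nth Leaf env i
  | ELeaf => Leaf
  | ENode a b => Node (ev env a) (ev env b)
  | ELet a b => ev (ev env a :: env) b
  | ECase a b c =>
      if ev env a is Node h t then ev [:: h, t & env] c else ev env b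
  | EFold l a f =>
      tfoldl (fun h acc => ev [:: h, acc & env] f) (ev env l) (ev env a)
  end.

Definition ct (env : seq tree) (e : expr) : nat := (exec env e).2.

Lemma tfoldl_cost_fst (g : tree -> tree -> tree) (c : tree -> tree -> nat)
    (st : tree -> tree * nat -> tree * nat) l v n :
  (forall h acc, st h acc = (g h acc.1, (acc.2 + c h acc.1)%N)) ->
  (tfoldl st l (v, n)).1 = tfoldl g l v.
Proof.
move=> Est; elim: l v n => [|h _ t IHt] v n //=.
by rewrite Est /= IHt.
Qed.

Lemma exec_fst env e : (exec env e).1 = ev env e.
Proof.
elim: e env => [i||a IHa b IHb|a IHa b IHb|a IHa b IHb c IHc|l IHl a IHa f IHf] env //=.
- rewrite -IHa -IHb.
  by case: (exec env a) => va ca; case: (exec env b).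
- rewrite -IHb -IHa.
  by case: (exec env a) => va ca /=; case: (exec _ b).
- rewrite -IHa; case: (exec env a) => va ca /=.
  case: va => [|h t] /=; first by rewrite -IHb; case: (exec _ b).
  by rewrite -IHc; case: (exec _ c).
- rewrite -IHl -IHa; case: (exec env l) => vl cl /=; case: (exec env a) => va ca /=.
  apply: (tfoldl_cost_fst (c := fun h acc => (exec [:: h, acc & env] f).2)) => h [acc n] /=.
  by rewrite -IHf; case: (exec _ f).
Qed.

(** [charge] adds the size of the value to every cost. Size bounds below therefore come for free
    from cost bounds. *)
Lemma tsize_ct env e : (tsize (ev env e) <= ct env e)%N.
Proof. by rewrite -exec_fst /ct; case: e => *; exact: leq_addr. Qed.

Lemma ct_var env i : ct env (EVar i) = tsize (nth Leaf env i).
Proof. by rewrite /ct /= addn0. Qed.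

Lemma ct_leaf env : ct env ELeaf = 1%N.
Proof. by []. Qed.

(** The charge for the pair is at most what its two components have already cost plus one, so
    doubling absorbs it. The rules for [ELet] and [ECase] absorb their charge in the same way. *)
Lemma ct_node env a b : (ct env (ENode a b) <= 2 * (ct env a + ct env b) + 1)%N.
Proof.
have := tsize_ct env a; have := tsize_ct env b; rewrite -!exec_fst /ct /=.
by case: (exec env a) => va ca; case: (exec env b) => vb cb /=; lia.
Qed.

Lemma ct_let env a b :
  (ct env (ELet a b) <= ct env a + 2 * ct (ev env a :: env) b)%N.
Proof.
have := tsize_ct (ev env a :: env) b; rewrite -!exec_fst /ct /=.
by case: (exec env a) => va ca /=; case: (exec _ b) => vb cb /=; lia.
Qed.

Lemma ct_case_leaf env a b c : ev env a = Leaf ->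
  (ct env (ECase a b c) <= ct env a + 2 * ct env b)%N.
Proof.
have := tsize_ct env b; rewrite -!exec_fst /ct /=.
case: (exec env a) => va ca /= le ->.
by move: le; case: (exec _ b) => vb cb /=; lia.
Qed.

Lemma ct_case_node env a b c h t : ev env a = Node h t ->
  (ct env (ECase a b c) <= ct env a + 2 * ct [:: h, t & env] c)%N.
Proof.
have := tsize_ct [:: h, t & env] c; rewrite -!exec_fst /ct /=.
case: (exec env a) => va ca /= le ->.
by move: le; case: (exec _ c) => vc cc /=; lia.
Qed.

Fixpoint tall (P : tree -> Prop) (l : tree) : Prop :=
  if l is Node h t then P h /\ tall P t else True.

Fixpoint tlen (l : tree) : nat := if l is Node _ t then (tlen t).+1 else 0.

Lemma tlen_tsize l : (tlen l <= tsize l)%N.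
Proof. by elim: l => //= h _ t; lia. Qed.

Lemma tsize_gt0 l : (0 < tsize l)%N.
Proof. by case: l. Qed.

Lemma tall_tsize l : tall (fun h => (tsize h <= tsize l)%N) l.
Proof.
suff H n : (tsize l <= n)%N -> tall (fun h => (tsize h <= n)%N) l by exact: H.
by elim: l => //= h _ t IHt lt_n; split; [lia | apply: IHt; lia].
Qed.

(** [A] bounds the start, [G] the growth of the accumulator per step, [S] the cost of a step and [n]
    the number of steps. Growth is additive, hence nested loops stay polynomial; [P] records what is
    known of the list entries. *)
Lemma ct_fold env l a f (P : tree -> Prop) A n G S :
  tall P (ev env l) -> (tlen (ev env l) <= n)%N -> (tsize (ev env a) <= A)%N ->
  (forall h acc, P h -> (tsize acc <= A + n * G)%N ->
     (tsize (ev [:: h, acc & env] f) <= tsize acc + G)%N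
     /\ (ct [:: h, acc & env] f <= S)%N) ->
  (tsize (ev env (EFold l a f)) <= A + n * G)%N
  /\ (ct env (EFold l a f) <= A + n * G + ct env l + ct env a + n * S)%N.
Proof.
move=> Pl le_n le_A step.
(* The induction carries the number [j] of steps already made, after which the accumulator has size
   at most [A + j * G]. *)
suff H : forall l v c j, tall P l -> (tlen l + j <= n)%N ->
    (tsize v <= A + j * G)%N ->
    let r := tfoldl (fun h acc =>
        let: (w, cw) := exec (h :: acc.1 :: env) f in (w, (acc.2 + cw)%N))
        l (v, c) in
    (tsize r.1 <= A + n * G)%N /\ (r.2 <= c + tlen l * S)%N.
  have := H (ev env l) (ev env a) (ct env l + ct env a)%N 0%N Pl.
  rewrite addn0 => /(_ le_n); rewrite mul0n addn0 => /(_ le_A).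
  rewrite -!exec_fst in le_n *; rewrite /ct /=.
  case: (exec env l) le_n => vl cl /= le_n; case: (exec env a) => va ca /= [h1 h2].
  have : (tlen vl * S <= n * S)%N by rewrite leq_mul2r le_n orbT.
  by split=> //; lia.
move=> {l Pl le_n} l; elim: l => [|h _ t IHt] v c j /=.
  move=> _ le_j le_v; split; last lia.
  have : (j * G <= n * G)%N by rewrite leq_mul2r; apply/orP; right; lia.
  by lia.
move=> [Ph Pt] le_j le_v.
have jn : (j.+1 * G <= n * G)%N by rewrite leq_mul2r; apply/orP; right; lia.
have [|h1 h2] := step h v Ph; first by move: jn; rewrite mulSn; lia.
move: h1 h2; rewrite -exec_fst /ct.
case: (exec _ f) => w cw /= h1 h2.
have := IHt w (c + cw)%N j.+1 Pt; rewrite mulSn.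
case=> [||h3 h4]; [lia | lia |].
by split=> //; rewrite mulSn; lia.
Qed.

(** A program that reads only the first [n] entries costs the same in every longer environment. This
    is what bounds alphabet-dependent subprograms by a constant. *)
Fixpoint eclosed (n : nat) (e : expr) : bool :=
  match e with
  | EVar i => i < n
  | ELeaf => true
  | ENode a b => eclosed n a && eclosed n b
  | ELet a b => eclosed n a && eclosed n.+1 b
  | ECase a b c => [&& eclosed n a, eclosed n b & eclosed n.+2 c]
  | EFold l a f => [&& eclosed n l, eclosed n a & eclosed n.+2 f]
  end%N.

Lemma tfoldl_ext (A : Type) (f g : tree -> A -> A) l a :
  (forall h a, f h a = g h a) -> tfoldl f l a = tfoldl g l a.
Proof. by move=> fg; elim: l a => //= h _ t IHt a; rewrite fg IHt. Qed.

Lemma exec_closed e env1 env2 :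
  eclosed (size env1) e -> exec (env1 ++ env2) e = exec env1 e.
Proof.
elim: e env1 => [i||a IHa b IHb|a IHa b IHb|a IHa b IHb c IHc|l IHl a IHa f IHf] env1 //=.
- by move=> lt_i; rewrite nth_cat lt_i.
- by case/andP=> ca cb; rewrite IHa // IHb.
- case/andP=> ca cb; rewrite IHa //; case: (exec env1 a) => va na.
  by rewrite -cat_cons IHb.
- case/and3P=> ca cb cc; rewrite IHa //; case: (exec env1 a) => [[|h t] na].
    by rewrite IHb.
  by rewrite -!cat_cons IHc.
- case/and3P=> cl ca cf; rewrite IHl // IHa //.
  case: (exec env1 l) => vl nl; case: (exec env1 a) => va na.
  congr (charge _); apply: tfoldl_ext => h acc.
  by rewrite -!cat_cons IHf.
Qed.

Lemma ct_closed e env1 env2 :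
  eclosed (size env1) e -> ct (env1 ++ env2) e = ct env1 e.
Proof. by move=> ce; rewrite /ct exec_closed. Qed.

(** * Source of the reduction program *)

Definition Eone := ENode ELeaf ELeaf.
Definition Ehead l := ECase l ELeaf (EVar 0).
Definition Etail l := ECase l ELeaf (EVar 1).
(** Booleans are the numbers 0 and 1. A unary number is a list of leaves, so folding over it
    iterates a step that many times. *)
Definition Eneg a := ECase a Eone ELeaf.
Definition Eadd a b := EFold a b (ENode ELeaf (EVar 1)).
Definition Esub a b := EFold b a (Etail (EVar 1)).
Definition Edist a b := Eadd (Esub a b) (Esub b a).
Definition Exor a b := EFold a b (Eneg (EVar 1)).
Definition Enth i z := Ehead (EFold i z (Etail (EVar 1))).
(** The head of the accumulator is the last number emitted; each step pushes its successor, and the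
    first step pushes 0. The list is thus decreasing. *)
Definition Erange n :=
  EFold n ELeaf
    (ENode (ECase (EVar 1) ELeaf (ENode ELeaf (EVar 0))) (EVar 1)).

(* [A] is the de Bruijn index of the alphabet, a list, outside the folds. *)
Definition Ewords n A :=
  EFold n (ENode ELeaf ELeaf)
    (EFold (EVar 1) ELeaf
      (EFold (EVar (A + 4)) (EVar 1)
        (ENode (ENode (EVar 0) (EVar 2)) (EVar 1)))).

(** Horner's scheme in base 2: the copy index gives the leading part, the word the binary digits
    after it. *)
Definition Eidx x c := EFold x c (Eadd (EVar 1) (Eadd (EVar 1) (EVar 0))).

(* [z] and [b] are evaluated inside the fold, so their variables are shifted
   by 2; the accumulator is (rest of x, (rest of w, index)). *)
Definition Eidx2 p x w c z b :=
  let X := Ehead (EVar 1) in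
  let W := Ehead (Etail (EVar 1)) in
  let I := Etail (Etail (EVar 1)) in
  let bit :=
    Exor (Ehead X) (Exor (Enth (EVar 0) z) (Exor b (Eneg (Ehead W)))) in
  Etail (Etail (EFold p (ENode x (ENode w c))
    (ENode (Etail X) (ENode (Etail W) (Eadd I (Eadd I bit)))))).

(** The number of coinciding pairs among the four copies; it is 0 exactly when they are pairwise
    distinct. *)
Definition Ecollisions :=
  let C i j := Eneg (Edist (EVar i) (EVar j)) in
  Eadd (C 6 4) (Eadd (C 6 2) (Eadd (C 6 0)
    (Eadd (C 4 2) (Eadd (C 4 0) (C 2 0)))))%N.

(* Environment, innermost first: c4, _, c3, _, c2, _, c1, _, w', _, w, _, z, _,
   b, _, y, _, x, _, noise words, noise alphabet, words in z, words in x, bits,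
   copies, p, p'; the second entry is the list of templates found so far. *)
Definition Etemplate :=
  ECase Ecollisions
    (ENode
      (ENode (Eidx (EVar 18) (EVar 6))
      (ENode (Eidx2 (EVar 26) (EVar 18) (EVar 10) (EVar 4)
                (EVar (12 + 2)) (EVar (14 + 2)))
      (ENode (Eidx (EVar 16) (EVar 2))
      (ENode (Eidx2 (EVar 27) (EVar 16) (EVar 8) (EVar 0)
                (EVar (12 + 2)) ELeaf)
        (EVar 14)))))
      (EVar 1))
    (EVar 3).

(** Loops over x, y, b, z, w, w', c1, c2, c3, c4. Each one pushes two entries, so the list it ranges
    over is found two places further per level, while [EVar 1] hands on the output collected so
    far. *)
Definition Eloops :=
  EFold (EVar 3) ELeaf
  (EFold (EVar 5) (EVar 1)
  (EFold (EVar 8) (EVar 1)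
  (EFold (EVar 8) (EVar 1)
  (EFold (EVar 8) (EVar 1)
  (EFold (EVar 10) (EVar 1)
  (EFold (EVar 17) (EVar 1)
  (EFold (EVar 19) (EVar 1)
  (EFold (EVar 21) (EVar 1)
  (EFold (EVar 23) (EVar 1) Etemplate))))))))).

(* Environment: p, p', k, s, m. *)
Definition Etemplates :=
  ELet (Erange (EVar 3))
  (ELet (Erange (ENode ELeaf Eone))
  (ELet (Ewords (EVar 4) 0)
  (ELet (Ewords (EVar 6) 1)
  (ELet (Erange (EVar 8))
  (ELet (Ewords (EVar 7) 0) Eloops))))).

(* Environment: s, k. *)
Definition Ewidth := EFold (EVar 1) (EVar 0) (Eadd (EVar 1) (EVar 1)).

(* [n] is evaluated inside the fold. *)
Definition Emuladd i n v := EFold i v (Eadd n (EVar 1)).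

(** A template holds indices within a cloud; the global index is the local one times the size of V
    plus the vertex. [EVar 20] is read inside a fold, so it denotes entry 18, the size of V; entries
    8 and 2 are the two vertices. *)
Definition Eemit :=
  let t1 := Etail (EVar 0) in
  let t2 := Etail t1 in
  let t3 := Etail t2 in
  ENode
    (ENode
      (ENode (Emuladd (Ehead (EVar 0)) (EVar 20) (EVar 8))
      (ENode (Emuladd (Ehead t1) (EVar 20) (EVar 8))
      (ENode (Emuladd (Ehead t2) (EVar 20) (EVar 2))
      (ENode (Emuladd (Ehead t3) (EVar 20) (EVar 2)) ELeaf))))
      (Etail t3))
    (EVar 1).

(** Pushes m, s, k, p', p in this order, which rebuilds the environment that [Etemplates] expects;
    the indices allow for the entries already pushed. *)
Definition Ecall_templates :=
  ELet (EVar 20) (ELet (EVar 13) (ELet (EVar 16) (ELet (EVar 4)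
    (ELet (EVar 11) Etemplates)))).

Definition Einner :=
  ECase (EVar 0) ELeaf (ECase (EVar 1) ELeaf
    (ECase (Edist (EVar 2) (EVar 8))
      (EFold Ecall_templates (EVar 5) Eemit)
      (EVar 7))).

Definition Eouter :=
  ECase (EVar 0) ELeaf (ECase (EVar 1) ELeaf
    (EFold (EVar 7) (EVar 5) Einner)).

Definition Ebody :=
  ECase (EVar 1) ELeaf (ECase (EVar 1) ELeaf (ECase (EVar 1) ELeaf
    (ECase (EVar 1) ELeaf
      (ENode
        (Emuladd (ELet (EVar 2) (ELet (EVar 1) Ewidth)) (EVar 6) ELeaf)
        (EFold (EVar 1) ELeaf Eouter))))).

Definition Elit n := iter n (ENode ELeaf) ELeaf.

(** The noise parameter is compiled in as a literal, since it depends on eta but not on the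
    instance. *)
Definition reduction (m : nat) : expr := ELet (Elit m) Ebody.

Lemma closed_templates : eclosed 5 Etemplates.
Proof. by []. Qed.

(** * Correctness of the program *)

Local Notation encs := (enc_seq enc_nat).

Lemma tfoldl_enc_seq (T A : Type) (enc : T -> tree) (f : tree -> A -> A) l a :
  tfoldl f (enc_seq enc l) a = foldl (fun a x => f (enc x) a) a l.
Proof. by elim: l a => //= x l IHl a. Qed.

Lemma tfoldl_enc_nat (A : Type) (f : tree -> A -> A) n a :
  tfoldl f (enc_nat n) a = iter n (f Leaf) a.
Proof. by elim: n a => //= n IHn a; rewrite IHn -iterSr. Qed.

Lemma enc_seq_map (T U : Type) (enc : U -> tree) (f : T -> U) l :
  enc_seq (fun x => enc (f x)) l = enc_seq enc [seq f x | x <- l].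
Proof. by elim: l => //= x l ->. Qed.

(** Outputs are pushed at the head, hence the reversal. Since the incoming accumulator [o] is
    arbitrary, the rule applies again to an inner fold that continues the output of the outer
    one. *)
Lemma ev_collect (T : eqType) (U : Type) (encT : T -> tree) (encU : U -> tree)
    env l a f (s : seq T) (o : seq U) (G : T -> seq U) :
  ev env l = enc_seq encT s -> ev env a = enc_seq encU o ->
  (forall x o', x \in s ->
     ev [:: encT x, enc_seq encU o' & env] f = enc_seq encU (rev (G x) ++ o')) ->
  ev env (EFold l a f)
    = enc_seq encU (rev (flatten [seq G x | x <- s]) ++ o).
Proof.
move=> /= -> ->; rewrite tfoldl_enc_seq.
elim: s o => //= x s IHs o step.
rewrite step ?mem_head // IHs => [|y o' ys]; last by apply: step; rewrite inE ys orbT.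
by rewrite rev_cat catA.
Qed.

Lemma ev_case_leaf env a b c :
  ev env a = Leaf -> ev env (ECase a b c) = ev env b.
Proof. by move=> /= ->. Qed.

Lemma ev_case_node env a b c h t :
  ev env a = Node h t -> ev env (ECase a b c) = ev [:: h, t & env] c.
Proof. by move=> /= ->. Qed.

Lemma ev_let env a b v : ev env a = v -> ev env (ELet a b) = ev (v :: env) b.
Proof. by move=> <-. Qed.

Definition xorn (p q : nat) : nat := iter p (fun n => (n == 0 : nat)) q.

Lemma ev_tail env l v : ev env l = v ->
  ev env (Etail l) = if v is Node _ t then t else Leaf.
Proof. by move=> /= ->. Qed.

Lemma ev_neg env a n : ev env a = enc_nat n -> ev env (Eneg a) = enc_nat (n == 0).
Proof. by move=> /= ->; case: n. Qed.

Lemma ev_add env a b x y : ev env a = enc_nat x -> ev env b = enc_nat y ->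
  ev env (Eadd a b) = enc_nat (x + y).
Proof. by move=> /= -> ->; rewrite tfoldl_enc_nat /enc_nat iterD. Qed.

Lemma ev_sub env a b x y : ev env a = enc_nat x -> ev env b = enc_nat y ->
  ev env (Esub a b) = enc_nat (x - y).
Proof.
move=> /= -> ->; rewrite tfoldl_enc_nat.
elim: y x => [|y IHy] x; first by rewrite subn0.
by rewrite iterS IHy subnS; case: (x - y).
Qed.

Lemma ev_dist env a b x y : ev env a = enc_nat x -> ev env b = enc_nat y ->
  ev env (Edist a b) = enc_nat ((x - y) + (y - x)).
Proof. by move=> Ha Hb; apply: ev_add; apply: ev_sub. Qed.

Lemma ev_xor env a b x y : ev env a = enc_nat x -> ev env b = enc_nat y ->
  ev env (Exor a b) = enc_nat (xorn x y).
Proof.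
move=> /= -> ->; rewrite tfoldl_enc_nat /xorn.
by elim: x => //= x ->; case: (iter _ _ _).
Qed.

Lemma ev_nth env i z n zs : ev env i = enc_nat n -> ev env z = encs zs ->
  ev env (Enth i z) = enc_nat (nth 0 zs n).
Proof.
move=> /= -> ->; rewrite tfoldl_enc_nat.
have -> : iter n (fun acc => match acc with Leaf => Leaf | Node _ t => t end)
    (encs zs) = encs (drop n zs).
  elim: n => [|n IHn]; first by rewrite drop0.
  rewrite iterS IHn -addn1 addnC -drop_drop.
  by case: (drop n zs) => //= x l; rewrite drop0.
by rewrite -[n in RHS]addn0 -nth_drop; case: (drop n zs).
Qed.

Definition range (n : nat) : seq nat := rev (iota 0 n).

Lemma ev_range env a n : ev env a = enc_nat n -> ev env (Erange a) = encs (range n).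
Proof.
move=> /= ->; rewrite tfoldl_enc_nat /range.
have iotaS j : rev (iota 0 j.+1) = j :: rev (iota 0 j).
  by rewrite -addn1 iotaD cats1 rev_rcons.
elim: n => // n IHn; rewrite iterS IHn iotaS.
by case: n {IHn} => // n; rewrite iotaS.
Qed.

(** Written with singletons and flattening, like the two nested loops of the program, so that
    [ev_collect] matches it literally. *)
Definition words_step (A : seq nat) (W : seq (seq nat)) : seq (seq nat) :=
  rev (flatten [seq flatten [seq [:: a :: w] | a <- A] | w <- W]).

Definition words (n : nat) (A : seq nat) : seq (seq nat) :=
  iter n (words_step A) [:: [::]].

Lemma ev_words env a n i A : ev env a = enc_nat n -> ev env (EVar i) = encs A ->
  ev env (Ewords a i) = enc_seq encs (words n A).
Proof.
move=> Ha HA; rewrite /Ewords [LHS]/= Ha tfoldl_enc_nat /words.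
elim: n {a Ha} => // n IHn; rewrite !iterS IHn.
have := @ev_collect _ _ encs encs
  [:: Leaf, enc_seq encs (iter n (words_step A) [:: [::]]) & env]
  (EVar 1) ELeaf (EFold (EVar (i + 4)) (EVar 1)
        (ENode (ENode (EVar 0) (EVar 2)) (EVar 1))) _ [::]
  (fun w => flatten [seq [:: a :: w] | a <- A]) erefl erefl.
rewrite cats0; apply=> w o _.
apply: (@ev_collect _ _ enc_nat encs) => //.
by rewrite addnC.
Qed.

Definition idx (x : seq nat) (c : nat) : nat := foldl (fun a b => a + (a + b)) c x.

Lemma ev_idx env x c xs n : ev env x = encs xs -> ev env c = enc_nat n ->
  ev env (Eidx x c) = enc_nat (idx xs n).
Proof.
move=> Hx Hc; rewrite /Eidx [LHS]/= Hx Hc tfoldl_enc_seq /idx.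
elim: xs n {x c Hx Hc} => // x xs IHxs n.
rewrite [LHS]/= [RHS]/= -IHxs; congr foldl.
by apply: (ev_add (env := [:: enc_nat x, enc_nat n & env]) (a := EVar 1)
  (b := Eadd (EVar 1) (EVar 0))) => //; apply: ev_add.
Qed.

(** The letter 0 of the noise alphabet means a flip, which has probability one over the alphabet
    size. *)
Definition bitn z b h x w := xorn x (xorn (nth 0 z h) (xorn b (w == 0))).

Definition word2 z b p x w : seq nat :=
  [seq bitn z b t.1 t.2.1 t.2.2 | t <- zip p (zip x w)].

(** Each letter of p consumes one letter of x and one of w and adds one binary digit. The hypotheses
    on [z] and [b] are stated under two extra entries because both are evaluated inside the fold. *)
Lemma ev_idx2 env p x w c z b ps xs ws n zs bn :
  size xs = size ps -> size ws = size ps ->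
  ev env p = encs ps -> ev env x = encs xs -> ev env w = encs ws ->
  ev env c = enc_nat n ->
  (forall h acc, ev [:: h, acc & env] z = encs zs) ->
  (forall h acc, ev [:: h, acc & env] b = enc_nat bn) ->
  ev env (Eidx2 p x w c z b) = enc_nat (idx (word2 zs bn ps xs ws) n).
Proof.
move=> sx sw Hp Hx Hw Hc Hz Hb; rewrite /Eidx2.
set f := ENode (Etail (Ehead _)) _.
have step h x0 xs' w0 ws' c0 :
    ev [:: enc_nat h, Node (encs (x0 :: xs')) (Node (encs (w0 :: ws')) (enc_nat c0)) & env] f
    = Node (encs xs') (Node (encs ws') (enc_nat (c0 + (c0 + bitn zs bn h x0 w0)))).
  rewrite /f [LHS]/=; congr (Node _ (Node _ _)).
  set env' := _ :: _ :: env.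
  apply: (ev_add (env := env') (a := Etail (Etail (EVar 1)))
    (b := Eadd (Etail (Etail (EVar 1)))
      (Exor (Ehead (Ehead (EVar 1))) (Exor (Enth (EVar 0) z)
        (Exor b (Eneg (Ehead (Ehead (Etail (EVar 1)))))))))) => //.
  apply: ev_add => //; apply: ev_xor => //; apply: ev_xor.
    by apply: ev_nth => //; apply: Hz.
  by apply: ev_xor; [apply: Hb | apply: ev_neg].
suff E : ev env (EFold p (ENode x (ENode w c)) f)
    = Node Leaf (Node Leaf (enc_nat (idx (word2 zs bn ps xs ws) n))).
  by rewrite (ev_tail (ev_tail E)).
rewrite -[LHS]/(tfoldl (fun h acc => ev [:: h, acc & env] f) (ev env p)
  (Node (ev env x) (Node (ev env w) (ev env c)))) Hp Hx Hw Hc tfoldl_enc_seq.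
(* The loop body is abstracted to any [g] obeying the one-step equation, which keeps the interpreter
   folded during the induction. *)
move: step; set g := fun a h => _ => step.
have {}step h x0 xs' w0 ws' c0 := step h x0 xs' w0 ws' c0 : g _ _ = _.
move: g step => {}g step.
elim: ps xs ws n sx sw {p x w c Hp Hx Hw Hc} => [|h ps IHps] [|x xs] [|w ws] n //= [sx] [sw].
by rewrite step IHps.
Qed.

Definition template : Type := (nat * (nat * (nat * (nat * nat))))%type.

Definition enc_template (t : template) : tree :=
  let: (i1, (i2, (i3, (i4, b)))) := t in
  Node (enc_nat i1) (Node (enc_nat i2) (Node (enc_nat i3)
    (Node (enc_nat i4) (enc_nat b)))).

Definition mk_template p p' x y b z w w' c1 c2 c3 c4 : template :=
  (idx x c1, (idx (word2 z b p x w) c2,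
    (idx y c3, (idx (word2 z 0 p' y w') c4, b)))).

Definition templates k s m p p' : seq template :=
  let X := words k (range 2) in
  let N := words k (range m) in
  flatten [seq flatten [seq flatten [seq flatten [seq flatten [seq flatten
    [seq flatten [seq flatten [seq flatten [seq flatten
      [seq if uniq [:: c1; c2; c3; c4]
           then [:: mk_template p p' x y b z w w' c1 c2 c3 c4] else [::]
      | c4 <- range s] | c3 <- range s] | c2 <- range s] | c1 <- range s]
      | w' <- N] | w <- N] | z <- words s (range 2)] | b <- range 2]
      | y <- X] | x <- X].

Lemma mem_words n A w : (w \in words n A) = (size w == n) && all (mem A) w.
Proof.
rewrite /words; elim: n w => [|n IHn] w; first by case: w.
rewrite iterS /words_step mem_rev; apply/flatten_mapP/idP.
  move=> [w' w'W /flatten_mapP [a aA]]; rewrite inE => /eqP ->.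
  by move: w'W; rewrite IHn => /andP [/eqP <- w'A]; rewrite /= eqxx aA.
case: w => // a w /=; rewrite eqSS => /and3P [sw aA wA].
exists w; first by rewrite IHn sw wA.
by apply/flatten_mapP; exists a => //; rewrite inE.
Qed.

Lemma words_uniq n A : uniq A -> uniq (words n A).
Proof.
move=> uA; elim: n => // n IHn; rewrite /words iterS /words_step rev_uniq.
rewrite -/(words n A).
have -> : flatten [seq flatten [seq [:: a :: w] | a <- A] | w <- words n A]
    = [seq a :: w | w <- words n A, a <- A].
  congr flatten; apply: eq_map => w; elim: A {uA IHn} => //= a A ->; done.
by apply: allpairs_uniq => // -[w a] [w' a'] _ _ [-> ->].
Qed.

Lemma ev_collisions c1 c2 c3 c4 env :
  nth Leaf env 6 = enc_nat c1 -> nth Leaf env 4 = enc_nat c2 ->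
  nth Leaf env 2 = enc_nat c3 -> nth Leaf env 0 = enc_nat c4 ->
  exists2 n, ev env Ecollisions = enc_nat n
    & (n == 0) = uniq [:: c1; c2; c3; c4].
Proof.
move=> H1 H2 H3 H4; eexists.
  rewrite /Ecollisions.
  repeat (first [apply: ev_add | apply: ev_neg; apply: ev_dist => /=]); eassumption.
have D x y : (x - y + (y - x) == 0)%N = (x == y) by lia.
by rewrite !D !addn_eq0 !eqb0 /= !inE !negb_or !andbT -!andbA.
Qed.

Lemma ev_template p p' x y b z w w' c1 c2 c3 c4 N MR Z X B C
    a1 a2 a3 a4 a5 a6 a7 a8 a9 o env :
  size x = size p -> size w = size p -> size y = size p' -> size w' = size p' ->
  ev [:: enc_nat c4, enc_seq enc_template o, enc_nat c3, a9, enc_nat c2, a8,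
         enc_nat c1, a7, encs w', a6, encs w, a5, encs z, a4, enc_nat b, a3,
         encs y, a2, encs x, a1, N, MR, Z, X, B, C, encs p, encs p' & env]
    Etemplate
  = enc_seq enc_template
      (rev (if uniq [:: c1; c2; c3; c4]
            then [:: mk_template p p' x y b z w w' c1 c2 c3 c4] else [::]) ++ o).
Proof.
move=> sx sw sy sw'; rewrite /Etemplate; set env' := _ :: _.
have [||||n En En0] := @ev_collisions c1 c2 c3 c4 env' => //.
rewrite -En0 /mk_template.
case: n En {En0} => [|n] En; last by rewrite (ev_case_node _ _ En).
rewrite (ev_case_leaf _ _ En).
have E2 := @ev_idx2 env' (EVar 26) (EVar 18) (EVar 10) (EVar 4)
                (EVar (12 + 2)) (EVar (14 + 2)) p x w c2 z b sx sw
                erefl erefl erefl erefl (fun _ _ => erefl) (fun _ _ => erefl).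
have E4 := @ev_idx2 env' (EVar 27) (EVar 16) (EVar 8) (EVar 0)
                (EVar (12 + 2)) ELeaf p' y w' c4 z 0 sy sw'
                erefl erefl erefl erefl (fun _ _ => erefl) (fun _ _ => erefl).
have E1 := @ev_idx env' (EVar 18) (EVar 6) x c1 erefl erefl.
have E3 := @ev_idx env' (EVar 16) (EVar 2) y c3 erefl erefl.
rewrite [RHS]/= -E1 -E2 -E3 -E4 //.
Qed.

Lemma ev_templates k s m p p' env : size p = k -> size p' = k ->
  ev [:: encs p, encs p', enc_nat k, enc_nat s, enc_nat m & env] Etemplates
  = enc_seq enc_template (rev (templates k s m p p')).
Proof.
move=> sp sp'; rewrite /Etemplates.
rewrite (@ev_let _ _ _ (encs (range s))); last exact: ev_range.
rewrite (@ev_let _ _ _ (encs (range 2))); last exact: ev_range.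
rewrite (@ev_let _ _ _ (enc_seq encs (words k (range 2)))); last exact: ev_words.
rewrite (@ev_let _ _ _ (enc_seq encs (words s (range 2)))); last exact: ev_words.
rewrite (@ev_let _ _ _ (encs (range m))); last exact: ev_range.
rewrite (@ev_let _ _ _ (enc_seq encs (words k (range m)))); last exact: ev_words.
rewrite /Eloops /templates -[rev _]cats0.
apply: (@ev_collect _ _ encs enc_template) => // x o1 xX.
apply: (@ev_collect _ _ encs enc_template) => // y o2 yX.
apply: (@ev_collect _ _ enc_nat enc_template) => // b o3 _.
apply: (@ev_collect _ _ encs enc_template) => // z o4 _.
apply: (@ev_collect _ _ encs enc_template) => // w o5 wN.
apply: (@ev_collect _ _ encs enc_template) => // w' o6 w'N.
apply: (@ev_collect _ _ enc_nat enc_template) => // c1 o7 _.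
apply: (@ev_collect _ _ enc_nat enc_template) => // c2 o8 _.
apply: (@ev_collect _ _ enc_nat enc_template) => // c3 o9 _.
apply: (@ev_collect _ _ enc_nat enc_template) => // c4 o10 _.
move: xX yX wN w'N; rewrite !mem_words.
move=> /andP [/eqP sx _] /andP [/eqP sy _] /andP [/eqP sw _] /andP [/eqP sw' _].
by apply: ev_template; rewrite ?sp ?sp'.
Qed.

Lemma ev_width s k env :
  ev [:: enc_nat s, enc_nat k & env] Ewidth = enc_nat (2 ^ k * s).
Proof.
set env' := _ :: _; rewrite -[LHS]/(tfoldl
  (fun h acc => ev [:: h, acc & env'] (Eadd (EVar 1) (EVar 1))) (enc_nat k) (enc_nat s)).
rewrite tfoldl_enc_nat; move: env' => env'; elim: k => [|n IHn]; first by rewrite mul1n.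
rewrite iterS IHn expnS -mulnA mul2n -addnn.
exact: (@ev_add [:: Leaf, enc_nat (2 ^ n * s) & env'] (EVar 1) (EVar 1)).
Qed.

Lemma ev_muladd env i n v x y z : ev env i = enc_nat x ->
  (forall h acc, ev [:: h, acc & env] n = enc_nat y) -> ev env v = enc_nat z ->
  ev env (Emuladd i n v) = enc_nat (x * y + z).
Proof.
move=> Hi Hn Hv; rewrite /Emuladd [LHS]/= Hi Hv tfoldl_enc_nat.
elim: x {Hi} => [|x IHx] //; rewrite iterS IHx mulSn -addnA.
by apply: (@ev_add [:: Leaf, _ & env] n (EVar 1)) => //; apply: Hn.
Qed.

(** Equations over natural numbers, as the program produces them; distinctness and index bounds are
    proved afterwards. *)
Definition raw_eqn : Type := (seq nat * nat)%type.

Definition enc_raw (r : raw_eqn) : tree := Node (encs r.1) (enc_nat r.2).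

Definition emit (nV v v' : nat) (t : template) : raw_eqn :=
  let: (i1, (i2, (i3, (i4, b)))) := t in
  ([:: i1 * nV + v; i2 * nV + v; i3 * nV + v'; i4 * nV + v'], b).

Section Reduction.

Variables (m k s : nat) (L : label_cover k s).

Definition pword (f : {ffun 'I_k -> 'I_s}) : seq nat := [seq val (f i) | i <- enum 'I_k].

Definition raw_eqns : seq raw_eqn :=
  rev (flatten [seq flatten [seq
    (if e'.1.1 == e.1.1
     then [seq emit (lcV L) e.1.2 e'.1.2 t | t <- rev (templates k s m (pword e.2) (pword e'.2))]
     else [::]) | e' : lc_edge _ _ k s <- lcE L] | e : lc_edge _ _ k s <- lcE L]).

Lemma ev_emit nV v v' t o a1 a2 a3 a4 a5 a6 a7 a8 a9 b1 b2 b3 b4 b5 env :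
  ev [:: enc_template t, enc_seq enc_raw o, enc_nat v', a1, a2, a3, a4, a5,
         enc_nat v, a6, a7, a8, a9, b1, b2, b3, b4, b5, enc_nat nV & env] Eemit
  = enc_seq enc_raw (emit nV v v' t :: o).
Proof.
case: t => i1 [i2 [i3 [i4 b]]]; rewrite /Eemit; set env' := _ :: _.
set t1 := Etail (EVar 0); set t2 := Etail t1; set t3 := Etail t2.
have mul i n v0 x y z := @ev_muladd env' i n v0 x y z.
have E1 := mul (Ehead (EVar 0)) (EVar 20) (EVar 8) i1 nV v erefl
  (fun _ _ => erefl) erefl.
have E2 := mul (Ehead t1) (EVar 20) (EVar 8) i2 nV v erefl
  (fun _ _ => erefl) erefl.
have E3 := mul (Ehead t2) (EVar 20) (EVar 2) i3 nV v' erefl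
  (fun _ _ => erefl) erefl.
have E4 := mul (Ehead t3) (EVar 20) (EVar 2) i4 nV v' erefl
  (fun _ _ => erefl) erefl.
by rewrite [RHS]/= /enc_raw [RHS]/= -E1 -E2 -E3 -E4.
Qed.

Lemma enc_edgeE nU nV (e : lc_edge nU nV k s) :
  enc_edge e = Node (enc_nat e.1.1) (Node (enc_nat e.1.2) (encs (pword e.2))).
Proof. by rewrite /enc_edge /pword -enc_seq_map. Qed.

Lemma size_pword f : size (pword f) = k.
Proof. by rewrite size_map size_enum_ord. Qed.

Lemma ev_inner nU nV (e e' : lc_edge nU nV k s) o a1 a2 a3 a4 a5 a6 a7 a8 env :
  ev [:: enc_edge e', enc_seq enc_raw o, enc_nat e.1.2, encs (pword e.2),
         enc_nat e.1.1, a1, a2, a3, enc_nat s, a4, enc_nat k, a5, enc_nat nV, a6,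
         a7, a8, enc_nat m & env] Einner
  = enc_seq enc_raw
      (rev (if e'.1.1 == e.1.1
            then [seq emit nV e.1.2 e'.1.2 t
                     | t <- rev (templates k s m (pword e.2) (pword e'.2))]
            else [::]) ++ o).
Proof.
rewrite enc_edgeE /Einner.
set p' := encs (pword e'.2); set p := encs (pword e.2).
set env1 := _ :: _ :: _.
rewrite -[LHS]/(ev [:: enc_nat e'.1.2, p', enc_nat e'.1.1, Node (enc_nat e'.1.2) p'
  & env1] (ECase (Edist (EVar 2) (EVar 8))
      (EFold Ecall_templates (EVar 5) Eemit) (EVar 7))).
set env2 := [:: enc_nat e'.1.2, _, _, _ & _].
have := @ev_dist env2 (EVar 2) (EVar 8) e'.1.1 e.1.1 erefl erefl.
have -> : (e'.1.1 == e.1.1) = (e'.1.1 - e.1.1 + (e.1.1 - e'.1.1) == 0)%N.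
  by rewrite -val_eqE /=; lia.
case: (_ + _)%N => [|n] En; last by rewrite (ev_case_node _ _ En).
rewrite (ev_case_leaf _ _ En).
have Et : ev env2 Ecall_templates =
    enc_seq enc_template (rev (templates k s m (pword e.2) (pword e'.2))).
  by apply: (@ev_templates k s m _ _ env2); rewrite size_pword.
have -> : [seq emit nV e.1.2 e'.1.2 t | t <- rev (templates k s m (pword e.2) (pword e'.2))]
  = flatten [seq [:: emit nV e.1.2 e'.1.2 t]
            | t <- rev (templates k s m (pword e.2) (pword e'.2))].
  by elim: (rev _) => //= t l ->.
apply: (@ev_collect _ _ enc_template enc_raw env2 Ecall_templates (EVar 5) Eemit) => //.
move=> t o' _; exact: ev_emit.
Qed.

Lemma ev_outer nU nV (e : lc_edge nU nV k s) (es : seq (lc_edge nU nV k s)) o a4 a5 a6 a7 env :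
  ev [:: enc_edge e, enc_seq enc_raw o, enc_nat s, enc_seq (@enc_edge _ _ k s) es,
         enc_nat k, a4, enc_nat nV, a5, a6, a7, enc_nat m & env] Eouter
  = enc_seq enc_raw
      (rev (flatten [seq (if e'.1.1 == e.1.1
            then [seq emit nV e.1.2 e'.1.2 t
                     | t <- rev (templates k s m (pword e.2) (pword e'.2))]
            else [::]) | e' : lc_edge _ _ k s <- es]) ++ o).
Proof.
rewrite enc_edgeE /Eouter.
set p := encs (pword e.2); set env1 := _ :: _ :: _.
rewrite -[LHS]/(ev [:: enc_nat e.1.2, p, enc_nat e.1.1, Node (enc_nat e.1.2) p
  & env1] (EFold (EVar 7) (EVar 5) Einner)).
apply: (@ev_collect _ _ (@enc_edge nU nV k s) enc_raw) => // e' o' _.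
exact: ev_inner.
Qed.

Lemma eval_reduction :
  eval (reduction m) (enc_lc L)
  = Node (enc_nat (2 ^ k * s * lcV L)) (enc_seq enc_raw raw_eqns).
Proof.
rewrite /eval exec_fst /reduction.
have El env : ev env (Elit m) = enc_nat m by rewrite /Elit; elim: m => //= n ->.
rewrite -[LHS]/(ev [:: ev [:: enc_lc L] (Elit m); enc_lc L] Ebody) El /enc_lc.
set E := enc_seq _ _; set t4 := Node (enc_nat s) E.
set t3 := Node (enc_nat k) t4; set t2 := Node (enc_nat (lcV L)) t3.
set t1 := Node _ t2.
set env := [:: enc_nat s; E; enc_nat k; t4; enc_nat (lcV L); t3; enc_nat (lcU L); t2;
  enc_nat m; t1].
rewrite -[LHS]/(Node
  (ev env (Emuladd (ELet (EVar 2) (ELet (EVar 1) Ewidth)) (EVar 6) ELeaf))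
  (ev env (EFold (EVar 1) ELeaf Eouter))).
congr Node.
  rewrite -[2 ^ k * s * _]addn0; apply: ev_muladd => //.
  exact: (@ev_width s k (enc_nat k :: env)).
rewrite /raw_eqns -[rev _]cats0.
apply: (@ev_collect _ _ (@enc_edge _ _ k s) enc_raw) => // e o _.
exact: ev_outer.
Qed.

End Reduction.

(** * Polynomial running time *)

(* Otherwise unification runs the interpreter. *)
Opaque ct.

Lemma ct_var_le env i B : (tsize (nth Leaf env i) <= B)%N -> (ct env (EVar i) <= B)%N.
Proof. by rewrite ct_var. Qed.

Lemma tall_true l : tall (fun=> True) l.
Proof. by elim: l => //= *; split. Qed.

Lemma tall_sub (P Q : tree -> Prop) l :
  (forall h, P h -> Q h) -> tall P l -> tall Q l.
Proof. by move=> PQ; elim: l => //= h _ t IHt [/PQ Qh /IHt]. Qed.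

Lemma ct_tail env l : (ct env (Etail l) <= 3 * ct env l + 2)%N.
Proof.
have := tsize_ct env l.
case El: (ev env l) => [|h t] /= le_l.
  by have := @ct_case_leaf env l ELeaf (EVar 1) El; rewrite ct_leaf /Etail; lia.
by have := @ct_case_node env l ELeaf (EVar 1) h t El; rewrite ct_var /Etail /=; lia.
Qed.

Lemma ct_head env l : (ct env (Ehead l) <= 3 * ct env l + 2)%N.
Proof.
have := tsize_ct env l.
case El: (ev env l) => [|h t] /= le_l.
  by have := @ct_case_leaf env l ELeaf (EVar 0) El; rewrite ct_leaf /Ehead; lia.
by have := @ct_case_node env l ELeaf (EVar 0) h t El; rewrite ct_var /Ehead /=; lia.
Qed.

Lemma tsize_tail env l : (tsize (ev env (Etail l)) <= tsize (ev env l))%N.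
Proof. by rewrite /=; case: (ev env l) => //= h t; lia. Qed.

Lemma tsize_head env l : (tsize (ev env (Ehead l)) <= tsize (ev env l))%N.
Proof. by rewrite /=; case: (ev env l) => //= h t; lia. Qed.

Lemma ct_add env a b x y ca cb :
  (tsize (ev env a) <= x)%N -> (tsize (ev env b) <= y)%N ->
  (ct env a <= ca)%N -> (ct env b <= cb)%N ->
  (tsize (ev env (Eadd a b)) <= y + x * 2)%N
  /\ (ct env (Eadd a b) <= y + x * 2 + ca + cb + x * (2 * (y + x * 2) + 3))%N.
Proof.
move=> Ha Hb Hca Hcb.
have [|h acc _ le_acc|h1 h2] := @ct_fold env a b (ENode ELeaf (EVar 1)) (fun=> True)
  y x 2 (2 * (y + x * 2) + 3)%N (tall_true _) _ Hb.
- by apply: leq_trans Ha; exact: tlen_tsize.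
- split; first by rewrite /=; lia.
  by have := ct_node [:: h, acc & env] ELeaf (EVar 1); rewrite ct_leaf ct_var /=; lia.
by split=> //; rewrite /Eadd; lia.
Qed.

Lemma ct_sub env a b x y ca cb :
  (tsize (ev env a) <= x)%N -> (tsize (ev env b) <= y)%N ->
  (ct env a <= ca)%N -> (ct env b <= cb)%N ->
  (tsize (ev env (Esub a b)) <= x)%N
  /\ (ct env (Esub a b) <= x + ca + cb + y * (3 * x + 2))%N.
Proof.
move=> Ha Hb Hca Hcb.
have [|h acc _ le_acc|h1 h2] := @ct_fold env b a (Etail (EVar 1)) (fun=> True)
  x y 0 (3 * x + 2)%N (tall_true _) _ Ha.
- by apply: leq_trans Hb; exact: tlen_tsize.
- split; first by rewrite addn0; exact: (tsize_tail [:: h, acc & env] (EVar 1)).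
  by have := ct_tail [:: h, acc & env] (EVar 1); rewrite ct_var /=; lia.
by split; rewrite /Esub; lia.
Qed.

(** This and the following cost expressions are left as the rules for [ct] produce them: only
    polynomial growth matters. *)
Definition dist_cost B : nat :=
  B + B * 2 + (B + B + B + B * (3 * B + 2)) + (B + B + B + B * (3 * B + 2))
  + B * (2 * (B + B * 2) + 3).

Lemma ct_dist env i j B :
  (tsize (nth Leaf env i) <= B)%N -> (tsize (nth Leaf env j) <= B)%N ->
  (ct env (Edist (EVar i) (EVar j)) <= dist_cost B)%N.
Proof.
move=> Hi Hj.
have [h1 h2] := @ct_sub env (EVar i) (EVar j) B B B B Hi Hj
  (ct_var_le Hi) (ct_var_le Hj).
have [h3 h4] := @ct_sub env (EVar j) (EVar i) B B B B Hj Hi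
  (ct_var_le Hj) (ct_var_le Hi).
by have [_ h5] := ct_add h1 h3 h2 h4.
Qed.

Definition muladd_size B : nat := B + B * (B * 2).
Definition muladd_step B : nat :=
  muladd_size B + B * 2 + B + muladd_size B
  + B * (2 * (muladd_size B + B * 2) + 3).
Definition muladd_cost ci B : nat := muladd_size B + ci + B + B * muladd_step B.

Lemma ct_muladd env i j v ci B :
  (tsize (ev env i) <= B)%N -> (tsize (nth Leaf env j) <= B)%N ->
  (tsize (ev env v) <= B)%N -> (ct env v <= B)%N -> (ct env i <= ci)%N ->
  (ct env (Emuladd i (EVar j.+2) v) <= muladd_cost ci B)%N.
Proof.
move=> Hi Hj Hv Hcv Hci.
have [|h acc _ le_acc|_ h2] := @ct_fold env i v (Eadd (EVar j.+2) (EVar 1))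
  (fun=> True) B B (B * 2) (muladd_step B) (tall_true _) _ Hv.
- by apply: leq_trans Hi; exact: tlen_tsize.
- pose env' := [:: h, acc & env].
  have := @ct_add env' (EVar j.+2) (EVar 1) B (tsize acc) B (tsize acc) Hj (leqnn _).
  rewrite !ct_var => /(_ Hj (leqnn _)) [h1 h2]; split=> //.
  apply: (leq_trans h2); rewrite /muladd_step -/(muladd_size B) in le_acc *.
  by rewrite !(leq_add, leq_mul, leqnn) //; lia.
by rewrite /Emuladd /muladd_cost /muladd_size; lia.
Qed.

(** At most four nested projections turn a cost B into 81 B + 80, by iterating c -> 3 c + 2. Four
    nested pairs built from parts of cost M turn into 30 M + 31, by iterating c -> 2 (M + c) + 1
    from 1. *)
Definition emit_cost B : nat :=
  2 * (30 * muladd_cost (81 * B + 80) B + 31 + (81 * B + 80)) + 1.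

Lemma ct_emit env B : (tsize (nth Leaf env 0) <= B)%N ->
  (tsize (nth Leaf env 2) <= B)%N -> (tsize (nth Leaf env 8) <= B)%N ->
  (tsize (nth Leaf env 18) <= B)%N ->
  (tsize (ev env Eemit) <= tsize (nth Leaf env 1) + (emit_cost B).+1)%N
  /\ (ct env Eemit <= 2 * (emit_cost B + tsize (nth Leaf env 1)) + 1)%N.
Proof.
move=> B0 B2 B8 B18; rewrite /Eemit.
set t1 := Etail (EVar 0); set t2 := Etail t1; set t3 := Etail t2.
set q := ENode (ENode _ _) (Etail t3).
have c1 := ct_tail env (EVar 0); have c2 := ct_tail env t1.
have c3 := ct_tail env t2; have c4 := ct_tail env t3.
have d0 := ct_head env (EVar 0); have d1 := ct_head env t1.
have d2 := ct_head env t2; have d3 := ct_head env t3.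
rewrite ct_var -/t1 -/t2 -/t3 in c1 c2 c3 d0.
have s1 := tsize_tail env (EVar 0); have s2 := tsize_tail env t1.
have s3 := tsize_tail env t2.
rewrite -[ev env (EVar 0)]/(nth Leaf env 0) -/t1 -/t2 -/t3 in s1 s2 s3.
have e0 := tsize_head env (EVar 0); have e1 := tsize_head env t1.
have e2 := tsize_head env t2; have e3 := tsize_head env t3.
rewrite -[ev env (EVar 0)]/(nth Leaf env 0) in e0.
pose M := muladd_cost (81 * B + 80) B.
have mul i j : (tsize (nth Leaf env j) <= B)%N -> (tsize (ev env i) <= B)%N ->
    (ct env i <= 81 * B + 80)%N -> (ct env (Emuladd i (EVar 20) (EVar j)) <= M)%N.
  by move=> Hj Hi Hc; apply: ct_muladd; rewrite ?ct_var.
have m0 : (ct env (Emuladd (Ehead (EVar 0)) (EVar 20) (EVar 8)) <= M)%N.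
  by apply: mul => //; lia.
have m1 : (ct env (Emuladd (Ehead t1) (EVar 20) (EVar 8)) <= M)%N.
  by apply: mul => //; lia.
have m2 : (ct env (Emuladd (Ehead t2) (EVar 20) (EVar 2)) <= M)%N.
  by apply: mul => //; lia.
have m3 : (ct env (Emuladd (Ehead t3) (EVar 20) (EVar 2)) <= M)%N.
  by apply: mul => //; lia.
have cq : (ct env q <= emit_cost B)%N.
  rewrite /q /emit_cost -/M.
  have := ct_node env; set N := ct env => nodeN.
  have n0 := nodeN (Emuladd (Ehead t3) (EVar 20) (EVar 2)) ELeaf.
  have n1 := nodeN (Emuladd (Ehead t2) (EVar 20) (EVar 2)) _.
  set l3 := ENode _ ELeaf in n0 *; have {}n1 := n1 l3.
  have := nodeN (Emuladd (Ehead t1) (EVar 20) (EVar 8)) _.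
  set l2 := ENode _ l3 in n1 *; move/(_ l2) => n2.
  have := nodeN (Emuladd (Ehead (EVar 0)) (EVar 20) (EVar 8)) _.
  set l1 := ENode _ l2 in n2 *; move/(_ l1) => n3.
  set l0 := ENode _ l1 in n3 *.
  have n4 := nodeN l0 (Etail t3).
  have : N ELeaf = 1 by rewrite /N ct_leaf.
  by rewrite /N in n0 n1 n2 n3 n4 *; lia.
split.
  by have := tsize_ct env q; rewrite -[ev env (ENode q _)]/(Node (ev env q) _) /=; lia.
by have := ct_node env q (EVar 1); rewrite ct_var; lia.
Qed.

Lemma tall_edges k s nU nV B (es : seq (lc_edge nU nV k s)) :
  (tsize (enc_seq (@enc_edge _ _ k s) es) <= B)%N ->
  tall (fun h => exists2 e : lc_edge nU nV k s, h = enc_edge e & (tsize (enc_edge e) <= B)%N)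
    (enc_seq (@enc_edge _ _ k s) es).
Proof.
elim: es => // e es IHes le_B.
have {}le_B : (tsize (enc_edge e) + tsize (enc_seq (@enc_edge _ _ k s) es) < B)%N.
  exact: le_B.
by split; [exists e => //; lia | apply: IHes; lia].
Qed.

Section Cost.

Variables (m k s : nat).

(** For fixed alphabets there are finitely many pairs of projections, and the sum of their costs
    bounds each of them. The exponentially long loops are thus never estimated. *)
Definition const_cost : nat :=
  \sum_(q : {ffun 'I_k -> 'I_s} * {ffun 'I_k -> 'I_s})
    ct [:: encs (pword q.1); encs (pword q.2); enc_nat k; enc_nat s; enc_nat m] Etemplates
  + ct [:: enc_nat s; enc_nat k] Ewidth + tsize (enc_nat m).

Lemma ct_templates (p p' : {ffun 'I_k -> 'I_s}) env :
  (ct [:: encs (pword p), encs (pword p'), enc_nat k, enc_nat s, enc_nat m & env]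
    Etemplates <= const_cost)%N.
Proof.
have le_addr3 (a b c d : nat) : (a <= a + b + c + d)%N by lia.
have -> := @ct_closed Etemplates [:: encs (pword p); encs (pword p'); enc_nat k;
  enc_nat s; enc_nat m] env closed_templates.
rewrite /const_cost (bigD1 (p, p')); last by [].
exact: le_addr3.
Qed.

Definition inner_growth B : nat := B * (emit_cost B).+1.

Definition inner_cost B A : nat :=
  B + 2 * (B + 2 * (dist_cost B + 2 * (A + inner_growth B + 63 * B + A
    + B * (2 * (emit_cost B + (A + inner_growth B)) + 1) + A))).

Variables (nU nV B : nat).
Hypotheses (le_k : (tsize (enc_nat k) <= B)%N) (le_s : (tsize (enc_nat s) <= B)%N)
  (le_nV : (tsize (enc_nat nV) <= B)%N) (le_const : (const_cost <= B)%N).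

Lemma ct_inner (e e' : lc_edge nU nV k s) acc A a1 a2 a3 a4 a5 a6 a7 a8 env :
  (tsize (enc_edge e) <= B)%N -> (tsize (enc_edge e') <= B)%N -> (tsize acc <= A)%N ->
  let env' := [:: enc_edge e', acc, enc_nat e.1.2, encs (pword e.2),
         enc_nat e.1.1, a1, a2, a3, enc_nat s, a4, enc_nat k, a5, enc_nat nV, a6,
         a7, a8, enc_nat m & env] in
  (tsize (ev env' Einner) <= tsize acc + inner_growth B)%N
  /\ (ct env' Einner <= inner_cost B A)%N.
Proof.
rewrite !enc_edgeE => se se' sA.
pose p' := encs (pword e'.2); pose p := encs (pword e.2).
rewrite /= -/p in se; rewrite /= -/p' in se'.
rewrite -/p -/p'; set env1 := _ :: _ :: _; cbv zeta; pose vp := Node (enc_nat e'.1.2) p'.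
set env2 := [:: enc_nat e'.1.2, p', enc_nat e'.1.1, vp & env1].
pose br := ECase (Edist (EVar 2) (EVar 8)) (EFold Ecall_templates (EVar 5) Eemit) (EVar 7).
pose env3 := [:: enc_nat e'.1.1, vp & env1].
have E1 : ev env1 Einner = ev env3 (ECase (EVar 1) ELeaf br) by [].
have E2 : ev env3 (ECase (EVar 1) ELeaf br) = ev env2 br by [].
have C1 : (ct env1 Einner <= B + 2 * ct env3 (ECase (EVar 1) ELeaf br))%N.
  have := @ct_case_node env1 (EVar 0) ELeaf (ECase (EVar 1) ELeaf br) _ _ erefl.
  by rewrite ct_var /= /Einner -/br -/env3; lia.
have C2 : (ct env3 (ECase (EVar 1) ELeaf br) <= B + 2 * ct env2 br)%N.
  have := @ct_case_node env3 (EVar 1) ELeaf br _ _ erefl.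
  by rewrite ct_var /= -/env2; lia.
rewrite E1 E2.
have Cd : (ct env2 (Edist (EVar 2) (EVar 8)) <= dist_cost B)%N.
  by apply: ct_dist => /=; lia.
suff [Sb Cb] : (tsize (ev env2 br) <= tsize acc + inner_growth B)%N /\
    (ct env2 br <= dist_cost B + 2 * (A + inner_growth B + 63 * B + A
    + B * (2 * (emit_cost B + (A + inner_growth B)) + 1) + A))%N.
  by split=> //; rewrite /inner_cost; lia.
case Ed: (ev env2 (Edist (EVar 2) (EVar 8))) => [|h t]; last first.
  have := @ct_case_node env2 _ (EFold Ecall_templates (EVar 5) Eemit) (EVar 7) _ _ Ed.
  rewrite /br (ev_case_node _ _ Ed) ct_var /=; split; first exact: leq_addr.
  by lia.
have := @ct_case_leaf env2 _ (EFold Ecall_templates (EVar 5) Eemit) (EVar 7) Ed.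
rewrite /br (ev_case_leaf _ _ Ed).
pose env4 := [:: p, p', enc_nat k, enc_nat s, enc_nat m & env2].
have Ec : ev env2 Ecall_templates = ev env4 Etemplates by [].
(* Five nested [ELet], each doubling the cost of its body: 1 + 2 + 4 + 8 + 16 + 32 = 63. *)
have Cc : (ct env2 Ecall_templates <= 63 * B)%N.
  have c5 : (ct env4 Etemplates <= const_cost)%N by exact: ct_templates.
  have c4 := ct_let [:: p', enc_nat k, enc_nat s, enc_nat m & env2] (EVar 11) Etemplates.
  have c3 := ct_let [:: enc_nat k, enc_nat s, enc_nat m & env2] (EVar 4)
    (ELet (EVar 11) Etemplates).
  have c2 := ct_let [:: enc_nat s, enc_nat m & env2] (EVar 16)
    (ELet (EVar 4) (ELet (EVar 11) Etemplates)).
  have c1 := ct_let (enc_nat m :: env2) (EVar 13)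
    (ELet (EVar 16) (ELet (EVar 4) (ELet (EVar 11) Etemplates))).
  have c0 := ct_let env2 (EVar 20)
    (ELet (EVar 13) (ELet (EVar 16) (ELet (EVar 4) (ELet (EVar 11) Etemplates)))).
  move: c5 c4 c3 c2 c1 c0; rewrite !ct_var.
  rewrite -[nth Leaf _ 11]/p -[nth Leaf _ 4]/p' -[nth Leaf _ 16]/(enc_nat k).
  rewrite -[nth Leaf _ 13]/(enc_nat s) -[nth Leaf _ 20]/(enc_nat m).
  rewrite -[ev _ (EVar 11)]/p -[ev _ (EVar 4)]/p' -[ev _ (EVar 16)]/(enc_nat k).
  rewrite -[ev _ (EVar 13)]/(enc_nat s) -[ev _ (EVar 20)]/(enc_nat m) -/env4.
  have : (tsize (enc_nat m) <= B)%N by apply: leq_trans le_const; exact: leq_addl.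
  rewrite /Ecall_templates; lia.
have St : (tsize (ev env2 Ecall_templates) <= B)%N.
  rewrite Ec; apply: leq_trans (tsize_ct _ _) _; apply: leq_trans le_const.
  exact: ct_templates.
(* The template list is no larger than the cost of producing it, so [B] bounds both its length and
   the size of its entries. *)
have [||t acc' Pt le_acc'|h1 h2] := @ct_fold env2 Ecall_templates (EVar 5) Eemit
  (fun h => (tsize h <= B)%N) (tsize acc) B (emit_cost B).+1
  (2 * (emit_cost B + (A + inner_growth B)) + 1)%N _ _ (leqnn _).
- apply: tall_sub (tall_tsize _) => h le_h; exact: leq_trans St.
- by apply: leq_trans St; exact: tlen_tsize.
- have lev' : (tsize (enc_nat e'.1.2) <= B)%N by lia.
  have lev : (tsize (enc_nat e.1.2) <= B)%N by lia.
  have [h1 h2] := @ct_emit [:: t, acc' & env2] B Pt lev' lev le_nV.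
  split; first exact: h1.
  apply: leq_trans h2 _; rewrite -[nth _ _ 1]/acc'.
  by move: le_acc'; rewrite -/(inner_growth B); lia.
split; first exact: h1.
move: h2; rewrite ct_var -[nth _ _ 5]/acc -/(inner_growth B); lia.
Qed.

Definition outer_growth : nat := B * inner_growth B.

Definition outer_cost A : nat :=
  B + 2 * (B + 2 * (A + outer_growth + B + A + B * inner_cost B (A + outer_growth))).

Lemma ct_outer (e : lc_edge nU nV k s) (es : seq (lc_edge nU nV k s)) acc A
    a4 a5 a6 a7 env :
  (tsize (enc_edge e) <= B)%N -> (tsize (enc_seq (@enc_edge _ _ k s) es) <= B)%N ->
  (tsize acc <= A)%N ->
  let env' := [:: enc_edge e, acc, enc_nat s, enc_seq (@enc_edge _ _ k s) es,
         enc_nat k, a4, enc_nat nV, a5, a6, a7, enc_nat m & env] in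
  (tsize (ev env' Eouter) <= tsize acc + outer_growth)%N
  /\ (ct env' Eouter <= outer_cost A)%N.
Proof.
move=> se ses sA; have se' := se; rewrite enc_edgeE in se'; rewrite enc_edgeE.
pose p := encs (pword e.2); rewrite /= -/p in se'; rewrite -/p.
set env1 := _ :: _ :: _; cbv zeta; pose vp := Node (enc_nat e.1.2) p.
set env2 := [:: enc_nat e.1.2, p, enc_nat e.1.1, vp & env1].
pose br := EFold (EVar 7) (EVar 5) Einner.
pose env3 := [:: enc_nat e.1.1, vp & env1].
have E1 : ev env1 Eouter = ev env3 (ECase (EVar 1) ELeaf br) by [].
have E2 : ev env3 (ECase (EVar 1) ELeaf br) = ev env2 br by [].
have C1 : (ct env1 Eouter <= B + 2 * ct env3 (ECase (EVar 1) ELeaf br))%N.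
  have := @ct_case_node env1 (EVar 0) ELeaf (ECase (EVar 1) ELeaf br) _ _ erefl.
  by rewrite ct_var /= /Eouter -/br -/env3; lia.
have C2 : (ct env3 (ECase (EVar 1) ELeaf br) <= B + 2 * ct env2 br)%N.
  have := @ct_case_node env3 (EVar 1) ELeaf br _ _ erefl.
  by rewrite ct_var /= -/env2; lia.
rewrite E1 E2.
have [|||h1 h2] := @ct_fold env2 (EVar 7) (EVar 5) Einner
  (fun h => exists2 e : lc_edge nU nV k s, h = enc_edge e & (tsize (enc_edge e) <= B)%N)
  (tsize acc) B (inner_growth B) (inner_cost B (A + outer_growth)) _ _ (leqnn _).
- exact: tall_edges.
- by apply: leq_trans (tlen_tsize _) _; exact: ses.
- move=> h acc' [e' -> se''] sacc'.
  apply: ct_inner => //; rewrite -/outer_growth in sacc'; lia.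
split; first exact: h1.
move: h2; rewrite !ct_var -[nth _ _ 5]/acc -[nth _ _ 7]/(enc_seq (@enc_edge _ _ k s) es).
by rewrite -/outer_growth -/br /outer_cost; lia.
Qed.

End Cost.

Definition total_cost clit B : nat :=
  let og := outer_growth B in
  clit + 2 * (B + 2 * (B + 2 * (B + 2 * (B + 2 * (2 * (muladd_cost (7 * B) B
    + (1 + B * og + B + 1 + B * outer_cost B (1 + B * og))) + 1))))).

Lemma closed_lit n i : eclosed i (Elit n).
Proof. by elim: n. Qed.

(** Input size plus [const_cost] bounds every piece of the input and every alphabet-dependent cost
    at once, so it serves as the single parameter [B]. *)
Lemma ct_reduction m k s (L : label_cover k s) :
  (cost (reduction m) (enc_lc L)
   <= total_cost (ct [::] (Elit m)) (Defs.tsize (enc_lc L) + const_cost m k s))%N.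
Proof.
rewrite -[cost _ _]/(ct [:: enc_lc L] (reduction m)) /reduction.
apply: leq_trans (ct_let _ _ _) _.
have El env : ev env (Elit m) = enc_nat m by rewrite /Elit; elim: m => //= n ->.
have -> := @ct_closed (Elit m) [::] [:: enc_lc L] (closed_lit m 0).
rewrite El /total_cost leq_add2l leq_mul2l /=.
set B := (tsize (enc_lc L) + _)%N.
have leB : (tsize (enc_lc L) <= B)%N by exact: leq_addr.
have le_const : (const_cost m k s <= B)%N by exact: leq_addl.
move: B leB le_const => B leB le_const.
move: leB; rewrite /enc_lc.
set E := enc_seq _ _; set t4 := Node (enc_nat s) E.
set t3 := Node (enc_nat k) t4; set t2 := Node (enc_nat (lcV L)) t3.
set t1 := Node _ t2 => leB.
have {}leB : (tsize (enc_nat (lcU L)) + tsize (enc_nat (lcV L)) + tsize (enc_nat k)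
  + tsize (enc_nat s) + tsize E + 4 <= B)%N by move: leB; rewrite /=; lia.
pose env1 := [:: enc_nat m; t1].
pose env2 := [:: enc_nat (lcU L), t2 & env1].
pose env3 := [:: enc_nat (lcV L), t3 & env2].
pose env4 := [:: enc_nat k, t4 & env3].
pose env5 := [:: enc_nat s, E & env4].
pose mul := Emuladd (ELet (EVar 2) (ELet (EVar 1) Ewidth)) (EVar 6) ELeaf.
pose loop := EFold (EVar 1) ELeaf Eouter.
have c1 := @ct_case_node env1 (EVar 1) ELeaf (ECase (EVar 1) ELeaf (ECase (EVar 1) ELeaf
    (ECase (EVar 1) ELeaf (ENode mul loop)))) _ _ erefl.
have c2 := @ct_case_node env2 (EVar 1) ELeaf (ECase (EVar 1) ELeaf
    (ECase (EVar 1) ELeaf (ENode mul loop))) _ _ erefl.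
have c3 := @ct_case_node env3 (EVar 1) ELeaf
    (ECase (EVar 1) ELeaf (ENode mul loop)) _ _ erefl.
have c4 := @ct_case_node env4 (EVar 1) ELeaf (ENode mul loop) _ _ erefl.
have c5 := ct_node env5 mul loop.
rewrite -/env5 in c4; rewrite -/env4 in c3; rewrite -/env3 in c2; rewrite -/env2 in c1.
rewrite ct_var -[nth _ _ _]/t1 in c1; rewrite ct_var -[nth _ _ _]/t2 in c2.
rewrite ct_var -[nth _ _ _]/t3 in c3; rewrite ct_var -[nth _ _ _]/t4 in c4.
have cm : (ct env5 mul <= muladd_cost (7 * B) B)%N.
  have cw : (ct [:: enc_nat s, enc_nat k & env5] Ewidth <= const_cost m k s)%N.
    have -> := @ct_closed Ewidth [:: enc_nat s; enc_nat k] env5 isT.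
    by rewrite /const_cost -addnA; apply: leq_trans (leq_addl _ _); apply: leq_addr.
  have w1 := ct_let env5 (EVar 2) (ELet (EVar 1) Ewidth).
  have w2 := ct_let (enc_nat k :: env5) (EVar 1) Ewidth.
  rewrite ct_var -[nth _ _ _]/(enc_nat k) -[ev _ (EVar 2)]/(enc_nat k) in w1.
  rewrite ct_var -[nth _ _ _]/(enc_nat s) -[ev _ (EVar 1)]/(enc_nat s) in w2.
  have Ew : ev env5 (ELet (EVar 2) (ELet (EVar 1) Ewidth))
      = ev [:: enc_nat s, enc_nat k & env5] Ewidth by [].
  have lenV : (tsize (nth Leaf env5 4) <= B)%N.
    by rewrite -[nth _ _ _]/(enc_nat (lcV L)); lia.
  apply: (@ct_muladd env5 (ELet (EVar 2) (ELet (EVar 1) Ewidth)) 4 ELeaf) => //.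
  - rewrite Ew; apply: leq_trans (tsize_ct _ _) _; lia.
  - by rewrite -[ev _ _]/Leaf -[tsize _]/1%N; lia.
  - by rewrite ct_leaf; lia.
  - by lia.
have leE : (tsize E <= B)%N by lia.
have [|||_ cl] := @ct_fold env5 (EVar 1) ELeaf Eouter
  (fun h => exists2 e : lc_edge (lcU L) (lcV L) k s,
     h = enc_edge e & (tsize (enc_edge e) <= B)%N)
  1 B (outer_growth B) (outer_cost B (1 + B * outer_growth B)) _ _ (leqnn _).
- exact: (tall_edges leE).
- apply: leq_trans (tlen_tsize _) _; exact: leE.
- move=> h acc [e -> se] sacc.
  by apply: ct_outer => //; lia.
rewrite ct_var ct_leaf -[nth _ _ _]/E -/loop in cl.
rewrite -/env1 /Ebody -/mul -/loop.
have [l1 l2 l3 l4] : [/\ tsize t1 <= B, tsize t2 <= B, tsize t3 <= B & tsize t4 <= B]%N.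
  by rewrite /t1 /t2 /t3 /t4 /=; split; lia.
lia.
Qed.

(** * Polynomially bounded functions *)

Definition poly_bounded (g : nat -> nat) : Prop :=
  exists C d, forall n, (0 < n)%N -> (g n <= C * n ^ d)%N.

Lemma pb_const c : poly_bounded (fun=> c).
Proof. by exists c, 0%N => n _; rewrite expn0 muln1. Qed.

Lemma pb_id : poly_bounded id.
Proof. by exists 1%N, 1%N => n _; rewrite mul1n expn1. Qed.

Lemma pb_add f g : poly_bounded f -> poly_bounded g -> poly_bounded (fun n => f n + g n)%N.
Proof.
move=> [C [d Hf]] [D [e Hg]]; exists (C + D)%N, (d + e)%N => n n0.
rewrite mulnDl leq_add //.
  by apply: leq_trans (Hf n n0) _; rewrite leq_mul2l leq_pexp2l ?orbT ?leq_addr.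
by apply: leq_trans (Hg n n0) _; rewrite leq_mul2l leq_pexp2l ?orbT ?leq_addl.
Qed.

Lemma pb_mul f g : poly_bounded f -> poly_bounded g -> poly_bounded (fun n => f n * g n)%N.
Proof.
move=> [C [d Hf]] [D [e Hg]]; exists (C * D)%N, (d + e)%N => n n0.
rewrite expnD mulnACA; exact: leq_mul (Hf n n0) (Hg n n0).
Qed.

Lemma pb_succ f : poly_bounded f -> poly_bounded (fun n => (f n).+1).
Proof.
move=> Hf; have [C [d H]] := pb_add Hf (pb_const 1).
by exists C, d => n n0; have := H n n0; rewrite addn1.
Qed.

Ltac pb :=
  lazymatch goal with
  | |- poly_bounded (fun=> ?c) => exact: pb_const
  | |- poly_bounded (fun n => n) => exact: pb_id
  | |- poly_bounded (fun n => addn (@?f n) (@?g n)) => apply: (@pb_add f g); pb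
  | |- poly_bounded (fun n => muln (@?f n) (@?g n)) => apply: (@pb_mul f g); pb
  | |- poly_bounded (fun n => S (@?f n)) => apply: (@pb_succ f); pb
  | |- _ => try assumption
  end.

Lemma pb_dist f : poly_bounded f -> poly_bounded (fun n => dist_cost (f n)).
Proof. by move=> Hf; rewrite /dist_cost; pb. Qed.

Lemma pb_muladd f g : poly_bounded f -> poly_bounded g ->
  poly_bounded (fun n => muladd_cost (f n) (g n)).
Proof. by move=> Hf Hg; rewrite /muladd_cost /muladd_step /muladd_size; pb. Qed.

Lemma pb_emit f : poly_bounded f -> poly_bounded (fun n => emit_cost (f n)).
Proof.
move=> Hf; rewrite /emit_cost; pb.
by apply: pb_muladd; pb.
Qed.

Lemma pb_inner f g : poly_bounded f -> poly_bounded g ->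
  poly_bounded (fun n => inner_cost (f n) (g n)).
Proof.
move=> Hf Hg; have He := pb_emit Hf; have Hd := pb_dist Hf.
by rewrite /inner_cost /inner_growth; pb.
Qed.

Lemma pb_outer_growth f : poly_bounded f -> poly_bounded (fun n => outer_growth (f n)).
Proof. by move=> Hf; have He := pb_emit Hf; rewrite /outer_growth /inner_growth; pb. Qed.

Lemma pb_outer f g : poly_bounded f -> poly_bounded g ->
  poly_bounded (fun n => outer_cost (f n) (g n)).
Proof.
move=> Hf Hg; have Ho := pb_outer_growth Hf.
by rewrite /outer_cost; pb; apply: pb_inner; pb.
Qed.

(** The noise parameter, k and s are fixed before the polynomial is chosen, so [const_cost] enters
    it as a constant. *)
Lemma efficient_reduction m : efficient (reduction m).
Proof.
move=> k s.
have Hf : poly_bounded (fun n => n + const_cost m k s)%N by pb.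
have Ho := pb_outer_growth Hf.
have [C [d H]] : poly_bounded (fun n =>
    total_cost (ct [::] (Elit m)) (n + const_cost m k s)).
  rewrite /total_cost; pb; first by apply: pb_muladd; pb.
  by apply: pb_outer; pb.
exists C, d => L; apply: leq_trans (ct_reduction m L) _.
exact: H (tsize_gt0 _).
Qed.

(** * The equations as sums over finite types *)

Definition cube (n : nat) : finType := {ffun 'I_n -> bool}.

Definition bits n (x : cube n) : seq nat := [seq nat_of_bool (x i) | i <- enum 'I_n].

(** The second point of a query. Having [m.+2] noise letters makes the factor 1 - 2 / (m + 2) = m /
    (m + 2) nonnegative. *)
Definition shift k s m (p : {ffun 'I_k -> 'I_s}) (x : cube k) (z : cube s)
    (w : {ffun 'I_k -> 'I_m.+2}) (b : bool) : cube k :=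
  [ffun i => x i (+) (z (p i) (+) (b (+) (w i == ord0)))].

Lemma idx_lt xs c : all (gtn 2) xs -> (idx xs c < c.+1 * 2 ^ size xs)%N.
Proof.
rewrite /idx; elim: xs c => [|x xs IHxs] c /=; first by rewrite muln1.
case/andP=> x2 /(IHxs (c + (c + x))%N) lt_xs.
apply: leq_trans lt_xs _; rewrite expnS mulnA leq_mul2r; apply/orP; right; lia.
Qed.

(** The accumulators after a digit agree by induction, and parity separates 2 c + x into c and the
    bit x. *)
Lemma idx_inj xs ys c d : size xs = size ys -> all (gtn 2) xs -> all (gtn 2) ys ->
  idx xs c = idx ys d -> xs = ys /\ c = d.
Proof.
rewrite /idx; elim: xs ys c d => [|x xs IHxs] [|y ys] c d //= [sxy].
case/andP=> x2 xs2 /andP [y2 ys2] /IHxs [] // -> E.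
by split; [congr (_ :: _); lia | lia].
Qed.

Lemma bits_lt n (x : cube n) : all (gtn 2) (bits x).
Proof. by apply/allP => _ /mapP [i _ ->] /=; case: (x i). Qed.

Lemma size_bits n (x : cube n) : size (bits x) = n.
Proof. by rewrite size_map size_enum_ord. Qed.

Lemma bits_inj n : injective (@bits n).
Proof.
move=> x y /eq_in_map E; apply/ffunP => i.
by have := E i (mem_enum _ i); case: (x i); case: (y i).
Qed.

(** A mixed-radix code of (v, x, c): remainder modulo [nV] recovers v, and the quotient is the
    Horner code of x and c. *)
Definition var nV k s (v : 'I_nV) (x : cube k) (c : 'I_s) : nat :=
  idx (bits x) c * nV + v.

Lemma var_lt nV k s v x c : (@var nV k s v x c < 2 ^ k * s * nV)%N.
Proof.
have lt_i : (idx (bits x) c < 2 ^ k * s)%N.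
  apply: leq_trans (idx_lt _ (bits_lt x)) _.
  by rewrite size_bits mulnC leq_mul2l ltn_ord orbT.
rewrite /var; apply: (@leq_trans ((idx (bits x) c).+1 * nV)).
  by rewrite mulSn addnC ltn_add2r ltn_ord.
by rewrite leq_mul2r lt_i orbT.
Qed.

Lemma var_inj nV k s v x c v' x' c' :
  @var nV k s v x c = var v' x' c' -> [/\ v = v', x = x' & c = c'].
Proof.
move=> E; have nV0 : (0 < nV)%N by case: v {E} => v lt_v; apply: leq_trans lt_v.
have Ev : v = v' :> nat.
  by have := congr1 (modn^~ nV) E; rewrite !modnMDl !modn_small.
have Ei : idx (bits x) c = idx (bits x') c'.
  by have := congr1 (divn^~ nV) E; rewrite !divnMDl // !divn_small // !addn0.
have [||| Ex Ec] := idx_inj _ _ _ Ei; rewrite ?bits_lt ?size_bits //.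
by split; [apply: val_inj | apply: bits_inj | apply: val_inj].
Qed.

Lemma xorn_bool (a b : bool) : xorn a b = (a (+) b : bool) :> nat.
Proof. by case: a b => -[]. Qed.

Lemma word2_shift k s m (p : {ffun 'I_k -> 'I_s}) (x : cube k) (z : cube s)
    (w : {ffun 'I_k -> 'I_m.+2}) (b : bool) :
  word2 (bits z) b (pword p) (bits x) [seq val (w i) | i <- enum 'I_k]
  = bits (shift p x z w b).
Proof.
rewrite /word2 /pword /bits; elim: (enum 'I_k) => //= i l ->.
congr (_ :: _); rewrite /bitn ffunE.
rewrite (nth_map (p i)) ?size_enum_ord // nth_ord_enum.
by rewrite -[(w i == ord0)]val_eqE /= !xorn_bool.
Qed.

Section Sums.

Variable V : nmodType.
Local Open Scope ring_scope.

(** The words over {0, ..., q - 1} are distinct and are exactly the value lists of functions into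
    [J], where [v] and [g] identify [J] with that range. *)
Lemma big_words n q (J : finType) (v : J -> nat) (g : nat -> J) (F : seq nat -> V) :
  cancel v g -> (forall a, (a < q)%N -> v (g a) = a) -> (forall j, (v j < q)%N) ->
  \sum_(w <- words n (range q)) F w
  = \sum_(f : {ffun 'I_n -> J}) F [seq v (f i) | i <- enum 'I_n].
Proof.
move=> vK gK vq.
pose enc (f : {ffun 'I_n -> J}) := [seq v (f i) | i <- enum 'I_n].
rewrite -[RHS](big_map enc xpredT F).
apply: perm_big; apply: uniq_perm.
- by apply: words_uniq; rewrite rev_uniq iota_uniq.
- rewrite map_inj_uniq ?index_enum_uniq // => f f' /eq_in_map E; apply/ffunP => i.
  exact: can_inj vK _ _ (E i (mem_enum _ i)).
move=> w; rewrite mem_words; apply/andP/mapP.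
  move=> [/eqP sw /allP wq]; exists [ffun i : 'I_n => g (nth 0%N w i)].
    exact: mem_index_enum.
  apply: (@eq_from_nth _ 0%N) => [|i]; first by rewrite size_map size_enum_ord.
  rewrite sw => lt_i; rewrite (nth_map (Ordinal lt_i)) ?size_enum_ord // ffunE.
  rewrite (nth_ord_enum _ (Ordinal lt_i)) gK //.
  have /wq : nth 0%N w i \in w by rewrite mem_nth // sw.
  by rewrite /= mem_rev mem_iota.
move=> [f _ ->]; rewrite size_map size_enum_ord eqxx; split=> //.
by apply/allP => _ /mapP [i _ ->]; rewrite /= mem_rev mem_iota /= add0n vq.
Qed.

Lemma big_words2 n (F : seq nat -> V) :
  \sum_(w <- words n (range 2)) F w = \sum_(x : cube n) F (bits x).
Proof.
by apply: (@big_words n 2 _ nat_of_bool (fun a => a == 1%N)) => [[]|[|[|]]|[]].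
Qed.

Lemma big_words_ord n q (F : seq nat -> V) :
  \sum_(w <- words n (range q.+1)) F w
  = \sum_(x : {ffun 'I_n -> 'I_q.+1}) F [seq val (x i) | i <- enum 'I_n].
Proof.
apply: (@big_words n q.+1 _ val inord) => [j|a lt_a|j]; first exact: inord_val.
  exact: inordK.
exact: ltn_ord.
Qed.

Lemma big_range n (F : nat -> V) : \sum_(c <- range n) F c = \sum_(c < n) F c.
Proof. by rewrite big_rev -[in LHS](subn0 n) -/(index_iota 0 n) big_mkord. Qed.

Lemma big_range2 (F : nat -> V) : \sum_(b <- range 2) F b = \sum_(b : bool) F b.
Proof. by rewrite big_range big_bool !big_ord_recl big_ord0 addr0 addrC. Qed.

End Sums.

Section RawEquations.

Variables (m k s : nat) (L : label_cover k s).

Definition req (e e' : lc_edge (lcU L) (lcV L) k s) (x y : cube k) (b : bool)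
    (z : cube s) (w w' : {ffun 'I_k -> 'I_m.+2}) (c1 c2 c3 c4 : 'I_s) : raw_eqn :=
  ([:: var e.1.2 x c1; var e.1.2 (shift e.2 x z w b) c2;
       var e'.1.2 y c3; var e'.1.2 (shift e'.2 y z w' false) c4], nat_of_bool b).

Lemma emit_mk_template (e e' : lc_edge (lcU L) (lcV L) k s) (x y : cube k) (b : bool)
    (z : cube s) (w w' : {ffun 'I_k -> 'I_m.+2}) (c1 c2 c3 c4 : 'I_s) :
  emit (lcV L) e.1.2 e'.1.2
    (mk_template (pword e.2) (pword e'.2) (bits x) (bits y) b (bits z)
      [seq val (w i) | i <- enum 'I_k] [seq val (w' i) | i <- enum 'I_k] c1 c2 c3 c4)
  = req e e' x y b z w w' c1 c2 c3 c4.
Proof.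
by rewrite /mk_template /req /emit /var -!word2_shift.
Qed.

Local Open Scope ring_scope.

(** The interface between program and analysis: from here on the equation list is known only through
    sums over it. *)
Lemma big_raw_eqns (V : nmodType) (F : raw_eqn -> V) :
  \sum_(r <- raw_eqns m.+2 L) F r
  = \sum_(e <- lcE L) \sum_(e' <- lcE L | e'.1.1 == e.1.1)
      \sum_(x : cube k) \sum_(y : cube k) \sum_(b : bool) \sum_(z : cube s)
      \sum_(w : {ffun 'I_k -> 'I_m.+2}) \sum_(w' : {ffun 'I_k -> 'I_m.+2})
      \sum_(c1 < s) \sum_(c2 < s) \sum_(c3 < s)
      \sum_(c4 < s | uniq [:: c1; c2; c3; c4])
        F (req e e' x y b z w w' c1 c2 c3 c4).
Proof.
rewrite /raw_eqns big_rev big_flatten big_map; apply: eq_bigr => e _.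
rewrite big_flatten big_map [RHS]big_mkcond; apply: eq_bigr => e' _.
case: ifP => _; last by rewrite big_nil.
rewrite big_map big_rev /templates.
rewrite big_flatten big_map big_words2; apply: eq_bigr => x _.
rewrite big_flatten big_map big_words2; apply: eq_bigr => y _.
rewrite big_flatten big_map big_range2; apply: eq_bigr => b _.
rewrite big_flatten big_map big_words2; apply: eq_bigr => z _.
rewrite big_flatten big_map big_words_ord; apply: eq_bigr => w _.
rewrite big_flatten big_map big_words_ord; apply: eq_bigr => w' _.
rewrite big_flatten big_map big_range; apply: eq_bigr => c1 _.
rewrite big_flatten big_map big_range; apply: eq_bigr => c2 _.
rewrite big_flatten big_map big_range; apply: eq_bigr => c3 _.
rewrite big_flatten big_map big_range [RHS]big_mkcond; apply: eq_bigr => c4 _.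
rewrite -(map_inj_uniq val_inj) /=.
by case: ifP => _; rewrite ?big_nil // big_seq1 emit_mk_template.
Qed.

End RawEquations.

(** * From raw equations to instances *)

Section Typed.

Local Open Scope ring_scope.

Definition untype n (e : lin_eqn n) : raw_eqn := (map val e.1, val e.2).

Definition valid_raw n (r : raw_eqn) : bool :=
  [&& size r.1 == 4, uniq r.1, all (gtn n) r.1 & (r.2 < 2)%N].

Lemma typed_eqn n r : valid_raw n r -> exists e : lin_eqn n, untype e = r.
Proof.
case: r => [[|a [|b [|c [|d [|]]]]] bt] //= /and4P [_ _].
case/and5P=> /= Ha Hb Hc Hd _ Hbt.
by exists ([tuple Ordinal Ha; Ordinal Hb; Ordinal Hc; Ordinal Hd], Ordinal Hbt).
Qed.

Lemma typed_eqns n rs : all (valid_raw n) rs ->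
  exists l : seq (lin_eqn n), map (@untype n) l = rs.
Proof.
elim: rs => [|r rs IHrs] /=; first by exists [::].
by case/andP=> /typed_eqn [e <-] /IHrs [l <-]; exists (e :: l).
Qed.

Lemma lin4_of_raw n rs : all (valid_raw n) rs ->
  exists (l : seq (lin_eqn n)) (ul : all (fun e : lin_eqn n => uniq e.1) l),
    map (@untype n) l = rs
    /\ enc_lin4 (Lin4 ul) = Node (enc_nat n) (enc_seq enc_raw rs).
Proof.
move=> vrs; have [l El] := typed_eqns vrs.
have ul : all (fun e : lin_eqn n => uniq e.1) l.
  apply/allP => e el; move/allP: vrs => /(_ (untype e)).
  by rewrite -El map_f // => /(_ isT) /and4P [_ + _ _]; rewrite /= map_inj_uniq //; exact: val_inj.
exists l, ul; split=> //.
rewrite /enc_lin4 /= -El -enc_seq_map; congr Node.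
elim: l {El ul} => //= e l ->; congr Node.
by rewrite /enc_eqn /enc_raw /= enc_seq_map.
Qed.

End Typed.

(** Distinct copies give distinct variables whatever the points and vertices are, as [var] is
    injective. *)
Lemma valid_req m k s (L : label_cover k s) e e' x y b z w w' c1 c2 c3 c4 :
  uniq [:: c1; c2; c3; c4] ->
  valid_raw (2 ^ k * s * lcV L) (@req m k s L e e' x y b z w w' c1 c2 c3 c4).
Proof.
move=> uc; rewrite /valid_raw /= !var_lt /= !inE !negb_or /=.
have var_neq v x' c v' y' c' : c != c' -> @var (lcV L) k s v x' c != @var (lcV L) k s v' y' c'.
  by apply: contraNneq => E; have [_ _ ->] := var_inj E.
move: uc; rewrite /= !inE !negb_or => /and4P [/and3P [n12 n13 n14] /andP [n23 n24] n34 _].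
by rewrite !var_neq //; case: b.
Qed.

(** The number of invalid equations is itself a sum over the list; [big_raw_eqns] turns it into a
    sum of zeros. *)
Lemma valid_raw_eqns m k s (L : label_cover k s) :
  all (valid_raw (2 ^ k * s * lcV L)) (raw_eqns m.+2 L).
Proof.
set P := valid_raw _; have := big_raw_eqns m L (fun r => (~~ P r : nat)).
rewrite [X in _ = X -> _]big1 => [|e _]; last first.
  do 10! (apply: big1 => ? _); apply: big1 => c4 uc.
  by rewrite /P valid_req.
move=> E; suff : has (predC P) (raw_eqns m.+2 L) = false by rewrite has_predC => /negbFE.
by rewrite has_count -sum1_count big_mkcond /=; apply/negbTE; rewrite -eqn0Ngt; apply/eqP.
Qed.

(** * Fourier analysis of the test *)

Local Open Scope ring_scope.

Section Fourier.

Variable R : realFieldType.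

Definition xadd n (x y : cube n) : cube n := [ffun i => x i (+) y i].
Definition cube0 n : cube n := [ffun=> false].
Definition chi n (a x : cube n) : R := \prod_i (-1) ^+ (a i && x i).
Definition wt n (a : cube n) : nat := #|[set i | a i]|.

Lemma chi_xadd n (a x y : cube n) : chi a (xadd x y) = chi a x * chi a y.
Proof.
rewrite /chi -big_split; apply: eq_bigr => i _.
by rewrite ffunE; case: (a i) => /=; rewrite ?signr_addb // mulr1.
Qed.

Lemma chi_sign n (a x : cube n) : exists b : bool, chi a x = (-1) ^+ b.
Proof.
rewrite /chi; elim/big_rec: _ => [|i y _ [b ->]]; first by exists false.
by exists ((a i && x i) (+) b); rewrite signr_addb.
Qed.

Lemma chi_cube0l n (x : cube n) : chi (cube0 n) x = 1.
Proof. by rewrite /chi big1 // => i _; rewrite ffunE. Qed.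

Lemma prod_const_sub n (a : cube n) (c : R) :
  \prod_(i < n) (if a i then c else 1) = c ^+ wt a.
Proof.
rewrite -big_mkcond prodr_const; congr (_ ^+ _).
by apply: eq_card => i; rewrite !inE.
Qed.

Lemma chi_const n (a : cube n) (b : bool) :
  chi a [ffun=> b] = (-1) ^+ (odd (wt a) && b).
Proof.
transitivity (\prod_(i < n) (if a i then (-1) ^+ b else 1) : R).
  by apply: eq_bigr => i _; rewrite ffunE; case: (a i).
by rewrite prod_const_sub -signr_odd -exprM; case: b; rewrite ?muln1 ?mul1n ?andbT ?andbF ?signr_odd ?mul0n.
Qed.

(** The sum factors over coordinates, and a coordinate where t is 1 contributes 1 - 1 = 0. *)
Lemma sum_chi n (t : cube n) : \sum_(a : cube n) chi a t = 2 ^+ n *+ (t == cube0 n).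
Proof.
rewrite /chi -(bigA_distr_bigA (fun i (c : bool) => (-1) ^+ (c && t i) : R)).
have E i : \sum_(c : bool) (-1) ^+ (c && t i) = (if t i then 0 else 2) :> R.
  by rewrite big_bool /=; case: (t i) => /=; lra.
rewrite (eq_bigr _ (fun i _ => E i)); case: eqP => [->|ne].
  rewrite (eq_bigr (fun=> 2)) => [|i _]; last by rewrite ffunE.
  by rewrite prodr_const card_ord.
have [i ti] : exists i, t i.
  apply/existsP; apply: contra_notT ne => /existsPn H.
  by apply/ffunP => i; rewrite ffunE; apply/negbTE.
by rewrite (bigD1 i) //= ti mul0r.
Qed.

(** Coefficients are not normalised; dividing the square by 2 ^ n makes the energies add up to the
    sum of the squares of [F]. *)
Definition hat n (F : cube n -> R) (a : cube n) : R := \sum_x F x * chi a x.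
Definition energy n (F : cube n -> R) (a : cube n) : R := hat F a ^+ 2 / 2 ^+ n.

Lemma energy_ge0 n (F : cube n -> R) a : 0 <= energy F a.
Proof. by rewrite divr_ge0 ?sqr_ge0 ?exprn_ge0. Qed.

(** Expanding the square gives characters at x + y + t; summing over frequencies leaves only y = x +
    t. *)
Lemma autocorrelation n (F : cube n -> R) (t : cube n) :
  \sum_x F x * F (xadd x t) = \sum_a energy F a * chi a t.
Proof.
have E a : energy F a * chi a t =
    \sum_x \sum_y F x * F y / 2 ^+ n * chi a (xadd (xadd x y) t).
  rewrite /energy expr2 /hat big_distrlr /= !mulr_suml; apply: eq_bigr => x _.
  rewrite !mulr_suml; apply: eq_bigr => y _; rewrite !chi_xadd; ring.
rewrite (eq_bigr _ (fun a _ => E a)) exchange_big; apply: eq_bigr => x _.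
rewrite exchange_big (bigD1 (xadd x t)) //= [X in _ + X]big1 ?addr0 => [|y ne].
  rewrite -mulr_sumr sum_chi.
  have -> : xadd (xadd x (xadd x t)) t = cube0 n.
    by apply/ffunP => i; rewrite !ffunE; case: (x i); case: (t i).
  by rewrite eqxx mulr1n mulfVK // expf_neq0 // pnatr_eq0.
rewrite -mulr_sumr sum_chi; case: eqP => [E0|_]; last by rewrite mulr0n mulr0.
case/eqP: ne; apply/ffunP => i; have := congr1 (fun f : cube n => f i) E0.
by rewrite !ffunE; case: (x i); case: (t i); case: (y i).
Qed.

Lemma parseval n (F : cube n -> R) : \sum_a energy F a = \sum_x F x ^+ 2.
Proof.
have := autocorrelation F (cube0 n).
rewrite (eq_bigr (fun x => F x ^+ 2)) => [->|x _]; last first.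
  by rewrite expr2; congr (_ * F _); apply/ffunP => i; rewrite !ffunE addbF.
apply: eq_bigr => a _; rewrite /chi big1 ?mulr1 // => i _.
by rewrite ffunE andbF.
Qed.

(** If psi z = -1 for some z, translation by z negates the sum, which must vanish; otherwise psi is
    constantly 1. *)
Lemma sum_character n (psi : cube n -> R) :
  (forall x y, psi (xadd x y) = psi x * psi y) ->
  (forall x, exists b : bool, psi x = (-1) ^+ b) ->
  (exists2 z, psi z = -1 & \sum_x psi x = 0)
  \/ ((forall z, psi z = 1) /\ \sum_x psi x = 2 ^+ n).
Proof.
move=> psiD psis.
have [/existsP [z /eqP Ez]|/existsPn H] := boolP [exists z, psi z == -1].
  left; exists z => //; have inv : involutive (@xadd n z).
    by move=> x; apply/ffunP => i; rewrite !ffunE addKb.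
  have := reindex_inj (inv_inj inv) (P := xpredT) (F := psi) (op := +%R) (x := 0).
  under [in X in _ = X -> _]eq_bigr do rewrite psiD Ez mulN1r.
  by rewrite sumrN => E; lra.
right; have psi1 z : psi z = 1.
  by have [[] E] := psis z => //; have := H z; rewrite E expr1 eqxx.
split=> //; rewrite (eq_bigr _ (fun z _ => psi1 z)) sumr_const card_ffun.
by rewrite card_bool card_ord natrX.
Qed.

Definition comp_cube k s (p : {ffun 'I_k -> 'I_s}) (z : cube s) : cube k :=
  [ffun i => z (p i)].

Definition noise k m (w : {ffun 'I_k -> 'I_m.+2}) : cube k := [ffun i => w i == ord0].

Lemma shiftE k s m p x z w b : @shift k s m p x z w b
  = xadd x (xadd (comp_cube p z) (xadd [ffun=> b] (noise w))).
Proof. by apply/ffunP => i; rewrite !ffunE. Qed.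

Definition noise_sum k m (a : cube k) : R :=
  \sum_(w : {ffun 'I_k -> 'I_m.+2}) chi a (noise w).

(** Coordinates are independent. One inside a contributes (m + 1) - 1 = m, one outside contributes m
    + 2. *)
Lemma noise_sumE k m (a : cube k) :
  noise_sum m a = m.+2%:R ^+ k * (m%:R / m.+2%:R) ^+ wt a.
Proof.
have q0 : m.+2%:R != 0 :> R by rewrite pnatr_eq0.
transitivity (\prod_(i < k) \sum_(o : 'I_m.+2) (-1) ^+ (a i && (o == ord0)) : R).
  rewrite bigA_distr_bigA; apply: eq_bigr => w _; apply: eq_bigr => i _.
  by rewrite ffunE.
rewrite -prod_const_sub -[X in _ ^+ X](card_ord k) -prodr_const -big_split /=.
apply: eq_bigr => i _; case: (a i) => /=; last first.
  by rewrite sumr_const card_ord mulr1.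
rewrite (bigD1 ord0) //= (eq_bigr (fun=> 1)) => [|o /negbTE -> //].
rewrite sumr_const cardC1 card_ord expr1 mulrCA divff // mulr1 /=.
by rewrite -[m.+1]addn1 natrD; ring.
Qed.

Lemma noise_sum_ge0 k m (a : cube k) : 0 <= noise_sum m a.
Proof. by rewrite noise_sumE mulr_ge0 ?exprn_ge0 ?divr_ge0. Qed.

(** Noise damps high frequencies enough to pay for the factor 1 / |a| lost in decoding. With d = 2 /
    q, induction gives (1 - d) ^ t (1 + t d) <= 1, because (1 - d)(1 + (t + 1) d) <= 1 + t d. *)
Lemma noise_sum_wt k m (a : cube k) :
  noise_sum m a * (wt a)%:R <= m.+2%:R ^+ k * (m.+2%:R / 2).
Proof.
rewrite noise_sumE -mulrA ler_wpM2l ?exprn_ge0 //.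
have q0 : 0 < m.+2%:R :> R by rewrite ltr0n.
set rho := m%:R / _; set q : R := m.+2%:R.
have rho0 : 0 <= rho by rewrite divr_ge0.
have Erho : rho = 1 - 2 / q.
  have mE : m%:R = q - 2 :> R by rewrite /q -addn2 natrD addrK.
  by rewrite /rho mE mulrBl divff // lt0r_neq0.
suff H t : rho ^+ t * (1 + t%:R * (2 / q)) <= 1.
  have := H (wt a); rewrite mulrDr mulr1 => {}H.
  have -> : rho ^+ wt a * (wt a)%:R = rho ^+ wt a * ((wt a)%:R * (2 / q)) * (q / 2).
    by rewrite -!mulrA [q^-1 * _]mulrA mulVf ?lt0r_neq0 // mul1r divff ?mulr1 // pnatr_eq0.
  apply: ler_piMl; first by rewrite divr_ge0 // ltW.
  by apply: le_trans H; rewrite lerDr exprn_ge0.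
elim: t => [|t IHt]; first by rewrite expr0 mul0r addr0 mulr1.
apply: le_trans IHt; rewrite exprSr -mulrA ler_wpM2l ?exprn_ge0 //.
rewrite Erho -[t.+1%:R]natr1; set d := 2 / q.
rewrite -subr_ge0; have -> : 1 + t%:R * d - (1 - d) * (1 + (t%:R + 1) * d)
    = (t%:R + 1) * d ^+ 2 by ring.
by rewrite mulr_ge0 ?sqr_ge0 // addr_ge0.
Qed.

Lemma bilinear_sum (I A : finType) (al be : A -> R) (u v : A -> I -> R) (d : I -> I -> R) :
  \sum_i \sum_i' (\sum_a al a * u a i) * (\sum_a be a * v a i') * d i i'
  = \sum_a \sum_a' al a * be a' * \sum_i \sum_i' u a i * v a' i' * d i i'.
Proof.
transitivity (\sum_i \sum_i' \sum_a \sum_a' al a * be a' * (u a i * v a' i' * d i i')).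
  apply: eq_bigr => i _; apply: eq_bigr => i' _; rewrite big_distrlr mulr_suml.
  by apply: eq_bigr => a _; rewrite mulr_suml; apply: eq_bigr => a' _ /=; ring.
rewrite (eq_bigr _ (fun i _ => exchange_big _ _ _ _ _ _)) exchange_big.
apply: eq_bigr => a _ /=.
rewrite (eq_bigr _ (fun i _ => exchange_big _ _ _ _ _ _)) exchange_big.
apply: eq_bigr => a' _ /=; rewrite mulr_sumr.
by apply: eq_bigr => i _; rewrite mulr_sumr.
Qed.

(** * The test on one pair of edges *)

Section LocalTest.

Variables (k s m : nat) (p p' : {ffun 'I_k -> 'I_s}).

(** With [eps] true the sign (-1) ^ b is present and the sum measures bias; with [eps] false it
    counts equations inside the support. *)
Definition local_test (eps : bool) (F G : cube k -> R) : R :=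
  \sum_(x : cube k) \sum_(y : cube k) \sum_(b : bool) \sum_(z : cube s)
  \sum_(w : {ffun 'I_k -> 'I_m.+2}) \sum_(w' : {ffun 'I_k -> 'I_m.+2})
    (-1) ^+ (eps && b) * (F x * F (shift p x z w b))
      * (G y * G (shift p' y z w' false)).

Definition sign_sum (eps : bool) (a : cube k) : R :=
  \sum_(b : bool) (-1) ^+ (eps && b) * chi a [ffun=> b].

Definition proj_sum (a a' : cube k) : R :=
  \sum_(z : cube s) chi a (comp_cube p z) * chi a' (comp_cube p' z).

Lemma exchange4 (I B Z W : finType) (F : I -> B -> Z -> W -> W -> R) :
  \sum_i \sum_b \sum_z \sum_w \sum_w' F i b z w w'
  = \sum_b \sum_z \sum_w \sum_w' \sum_i F i b z w w'.
Proof.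
rewrite exchange_big; apply: eq_bigr => b _; rewrite exchange_big.
apply: eq_bigr => z _; rewrite exchange_big.
by apply: eq_bigr => w _; rewrite exchange_big.
Qed.

(** For fixed b, z, w, w' the sums over x and y are two autocorrelations; the characters at the
    shifts then split into independent factors for b, z, w and w'. *)
Lemma local_testE eps F G :
  local_test eps F G = \sum_a \sum_a' energy F a * energy G a'
    * (sign_sum eps a * proj_sum a a' * (noise_sum m a * noise_sum m a')).
Proof.
rewrite /local_test.
have E4 (f : bool -> R) (g : cube s -> R) (h h' : {ffun 'I_k -> 'I_m.+2} -> R) :
    (\sum_b f b) * (\sum_z g z) * ((\sum_w h w) * (\sum_w h' w))
    = \sum_b \sum_z \sum_w \sum_w' f b * g z * (h w * h' w').
  rewrite [X in _ * X]big_distrlr [X in X * _]big_distrlr /= mulr_suml.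
  apply: eq_bigr => b _; rewrite mulr_suml; apply: eq_bigr => z _.
  by rewrite mulr_sumr; apply: eq_bigr => w _; rewrite mulr_sumr.
transitivity (\sum_(a : cube k) \sum_(a' : cube k) \sum_(b : bool) \sum_(z : cube s)
    \sum_(w : {ffun 'I_k -> 'I_m.+2}) \sum_(w' : {ffun 'I_k -> 'I_m.+2})
    energy F a * energy G a' * ((-1) ^+ (eps && b) * chi a [ffun=> b]
      * (chi a (comp_cube p z) * chi a' (comp_cube p' z))
      * (chi a (noise w) * chi a' (noise w')) : R)); last first.
  apply: eq_bigr => a _; apply: eq_bigr => a' _; rewrite E4.
  do 4! (rewrite mulr_sumr; apply: eq_bigr => ? _).
  by [].
rewrite (eq_bigr _ (fun x _ => exchange4 _)) exchange4.
rewrite [RHS](eq_bigr _ (fun x _ => exchange4 _)) [RHS]exchange4.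
apply: eq_bigr => b _; apply: eq_bigr => z _.
apply: eq_bigr => w _; apply: eq_bigr => w' _.
transitivity ((-1) ^+ (eps && b) * ((\sum_x F x * F (shift p x z w b))
    * (\sum_y G y * G (shift p' y z w' false)))).
  rewrite big_distrlr /= mulr_sumr; apply: eq_bigr => x _; rewrite mulr_sumr.
  by apply: eq_bigr => y _; rewrite -mulrA.
rewrite (eq_bigr _ (fun x _ => congr1 (fun u => F x * F u) (shiftE p x z w b))).
rewrite [in X in _ * X](eq_bigr _
  (fun y _ => congr1 (fun u => G y * G u) (shiftE p' y z w' false))).
rewrite !autocorrelation big_distrlr /= mulr_sumr; apply: eq_bigr => a _.
rewrite mulr_sumr; apply: eq_bigr => a' _.
rewrite !chi_xadd !chi_const andbF expr0; ring.
Qed.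

Lemma sign_sum_false a : 0 <= sign_sum false a.
Proof. by rewrite /sign_sum big_bool /= !chi_const; case: (odd _) => /=; lra. Qed.

Lemma sign_sum_true a : sign_sum true a = if odd (wt a) then 2 else 0.
Proof. by rewrite /sign_sum big_bool /= !chi_const; case: (odd _) => /=; lra. Qed.

Lemma proj_sumP a a' :
  (exists2 z, chi a (comp_cube p z) * chi a' (comp_cube p' z) = -1 & proj_sum a a' = 0)
  \/ ((forall z, chi a (comp_cube p z) * chi a' (comp_cube p' z) = 1)
      /\ proj_sum a a' = 2 ^+ s).
Proof.
apply: (@sum_character s (fun z => chi a (comp_cube p z) * chi a' (comp_cube p' z))).
  have D (q : {ffun 'I_k -> 'I_s}) x y :
      comp_cube q (xadd x y) = xadd (comp_cube q x) (comp_cube q y).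
    by apply/ffunP => i; rewrite !ffunE.
  by move=> x y; rewrite !D !chi_xadd; ring.
move=> z; have [b ->] := chi_sign a (comp_cube p z).
have [b' ->] := chi_sign a' (comp_cube p' z).
by exists (b (+) b'); rewrite signr_addb.
Qed.

Lemma proj_sum_ge0 a a' : 0 <= proj_sum a a'.
Proof. by case: (proj_sumP a a') => [[z _ ->]|[_ ->]] //; rewrite exprn_ge0. Qed.

(** A nonzero sum forces the character in z to be constantly 1, which a suitable z refutes if the
    two projected sets are disjoint. *)
Lemma proj_sum_agree a a' : odd (wt a) -> proj_sum a a' != 0 ->
  exists i i', [/\ a i, a' i' & p i = p' i'].
Proof.
move=> odd_a; case: (proj_sumP a a') => [[z _ ->]|[psi1 _ _]]; first by rewrite eqxx.
have [/existsP [i /existsP [i' /and3P [ai ai' /eqP Ei]]]|/existsPn H] := boolP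
    [exists i, exists i', [&& a i, a' i' & p i == p' i']].
  by exists i, i'.
(* The indicator of the projection of a: the first factor is (-1) ^ |a| = -1, and disjointness makes
   the second one 1. *)
pose z0 : cube s := [ffun j => [exists i, a i && (p i == j)]].
have := psi1 z0.
have -> : chi a (comp_cube p z0) = -1.
  rewrite /chi (eq_bigr (fun i => if a i then -1 else 1)) ?prod_const_sub.
    by rewrite -signr_odd odd_a.
  move=> i _; rewrite !ffunE; case ai: (a i) => //=.
  by rewrite (_ : [exists i0, _]) //; apply/existsP; exists i; rewrite ai eqxx.
have -> : chi a' (comp_cube p' z0) = 1.
  rewrite /chi big1 // => i' _; rewrite !ffunE; case ai': (a' i') => //=.
  case: existsP => // -[i /andP [ai /eqP Ei]].
  by have /existsPn /(_ i') := H i; rewrite ai ai' Ei eqxx.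
by lra.
Qed.

(** The unnormalised law of a label drawn uniformly from a frequency that is itself drawn by energy.
    The empty frequency contributes nothing. *)
Definition decode (F : cube k -> R) (i : 'I_k) : R :=
  \sum_a energy F a * ((a i)%:R / (wt a)%:R).

(** Compared frequency by frequency: for odd |a| and nonzero [proj_sum], two random labels agree
    with probability at least 1 / (|a| |a'|), and [noise_sum_wt] supplies the matching decay. *)
Lemma local_test_upper F G :
  local_test true F G <= 2 * 2 ^+ s * (m.+2%:R ^+ k * (m.+2%:R / 2)) ^+ 2
    * \sum_i \sum_i' decode F i * decode G i' * (p i == p' i')%:R.
Proof.
set Q := m.+2%:R ^+ k * (m.+2%:R / 2).
have Q0 : 0 <= Q by rewrite mulr_ge0 ?exprn_ge0 ?divr_ge0.
rewrite (bilinear_sum (energy F) (energy G) (fun a i => (a i)%:R / (wt a)%:R)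
  (fun a i => (a i)%:R / (wt a)%:R) (fun i i' => (p i == p' i')%:R)).
rewrite local_testE mulr_sumr; apply: ler_sum => a _.
rewrite mulr_sumr; apply: ler_sum => a' _.
rewrite [leRHS]mulrCA; apply: ler_wpM2l; first by rewrite mulr_ge0 ?energy_ge0.
set D := \sum_i _.
have D0 : 0 <= D.
  by do 2! (apply: sumr_ge0 => ? _); rewrite !mulr_ge0 ?invr_ge0 ?ler0n.
have RHS0 : 0 <= 2 * 2 ^+ s * Q ^+ 2 * D.
  apply: mulr_ge0 D0; apply: mulr_ge0; last exact: exprn_ge0.
  by apply: mulr_ge0 => //; apply: exprn_ge0.
rewrite sign_sum_true; case: ifP => odd_a; last by rewrite !mul0r.
have [->|nz] := eqVneq (proj_sum a a') 0; first by rewrite mulr0 mul0r.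
have -> : proj_sum a a' = 2 ^+ s.
  by case: (proj_sumP a a') nz => [[z _ ->]|[_ ->]] //; rewrite eqxx.
rewrite -[leRHS]mulrA ler_wpM2l ?mulr_ge0 ?exprn_ge0 //.
have [i [i' [ai ai' Ei]]] := proj_sum_agree odd_a nz.
have wt_gt0 (c : cube k) j : c j -> 0 < (wt c)%:R :> R.
  by move=> cj; rewrite ltr0n; apply/card_gt0P; exists j; rewrite inE.
have w0 := wt_gt0 _ _ ai; have w0' := wt_gt0 _ _ ai'.
(* Keep only the agreeing pair (i, i'); every other term is nonnegative. *)
have leD : ((wt a)%:R * (wt a')%:R)^-1 <= D.
  rewrite /D (bigD1 i) //= (bigD1 i') //= ai ai' Ei eqxx !mul1r mulr1 invfM -addrA.
  rewrite lerDl addr_ge0 //; first by apply: sumr_ge0 => ? _; rewrite !mulr_ge0 ?invr_ge0 ?ler0n.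
  by do 2! (apply: sumr_ge0 => ? _); rewrite !mulr_ge0 ?invr_ge0 ?ler0n.
apply: le_trans (ler_wpM2l _ leD); last by rewrite exprn_ge0.
rewrite ler_pdivlMr ?mulr_gt0 // mulrACA expr2.
by apply: ler_pM; rewrite ?mulr_ge0 ?noise_sum_ge0 ?noise_sum_wt.
Qed.

(** Without signs every Fourier term is nonnegative, so the empty pair of frequencies alone is a
    lower bound. *)
Lemma local_test_lower F G :
  2 * 2 ^+ s * (m.+2%:R ^+ k) ^+ 2 * (energy F (cube0 k) * energy G (cube0 k))
  <= local_test false F G.
Proof.
have wt0 : wt (cube0 k) = 0%N.
  by apply/eqP; rewrite cards_eq0; apply/eqP/setP => i; rewrite !inE ffunE.
have T0 a a' : 0 <= energy F a * energy G a'
    * (sign_sum false a * proj_sum a a' * (noise_sum m a * noise_sum m a')).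
  apply: mulr_ge0; first by apply: mulr_ge0; exact: energy_ge0.
  apply: mulr_ge0; last by apply: mulr_ge0; exact: noise_sum_ge0.
  by apply: mulr_ge0; [exact: sign_sum_false | exact: proj_sum_ge0].
apply: (@le_trans _ _ (energy F (cube0 k) * energy G (cube0 k)
    * (sign_sum false (cube0 k) * proj_sum (cube0 k) (cube0 k)
    * (noise_sum m (cube0 k) * noise_sum m (cube0 k))))); last first.
  rewrite local_testE (bigD1 (cube0 k)) //= (bigD1 (cube0 k)) //= -addrA.
  rewrite lerDl addr_ge0 //; first by apply: sumr_ge0 => a _; exact: T0.
  by do 2! (apply: sumr_ge0 => ? _); exact: T0.
have -> : sign_sum false (cube0 k) = 2.
  by rewrite /sign_sum big_bool /= !chi_cube0l; lra.
have -> : proj_sum (cube0 k) (cube0 k) = 2 ^+ s.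
  rewrite /proj_sum (eq_bigr (fun=> 1)) => [|z _]; last by rewrite !chi_cube0l mulr1.
  by rewrite sumr_const card_ffun card_bool card_ord natrX.
by rewrite !noise_sumE wt0 expr0 mulr1 -expr2 mulrC.
Qed.

Lemma decode_ge0 F i : 0 <= decode F i.
Proof. by apply: sumr_ge0 => a _; rewrite mulr_ge0 ?energy_ge0 ?divr_ge0. Qed.

Lemma sum_decode F : \sum_i decode F i <= \sum_x F x ^+ 2.
Proof.
rewrite -parseval exchange_big; apply: ler_sum => a _ /=.
rewrite -mulr_sumr; apply: ler_piMr; first exact: energy_ge0.
rewrite -mulr_suml -natr_sum.
have -> : (\sum_i a i)%N = wt a.
  rewrite /wt -sum1_card [RHS]big_mkcond; apply: eq_bigr => i _.
  by rewrite inE; case: (a i).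
by case: (wt a) => [|n]; rewrite ?mul0r // divff // pnatr_eq0.
Qed.

End LocalTest.
End Fourier.

(** * Fractional labelings *)

Section LabelCover.

Variables (R : realType) (k s : nat) (L : label_cover k s).

Local Notation E := (lcE L).
Local Notation edge := (lc_edge (lcU L) (lcV L) k s).

Lemma edges_gt0 : 0 < (size E)%:R :> R.
Proof. by rewrite ltr0n; exact: lc_nonempty. Qed.

Lemma Val_max :
  Val R L * (size E)%:R = (\max_(l : labeling L) count (lc_sat l) E)%:R.
Proof. by rewrite /Val divfK // lt0r_neq0 // edges_gt0. Qed.

Lemma count_le_Val (l : labeling L) : (count (lc_sat l) E)%:R <= Val R L * (size E)%:R.
Proof. by rewrite Val_max ler_nat; exact: (leq_bigmax l). Qed.

Lemma some_edge : exists e : edge, e \in E.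
Proof. by have := lc_nonempty L; case: (lcE L) => // e l _; exists e; rewrite inE eqxx. Qed.

Fact some_label : 'I_k.
Proof. exact: Ordinal (lc_labels L). Qed.

Lemma ord_s_nonempty : (0 < s)%N.
Proof.
have [e _] := some_edge.
by apply: leq_trans (ltn_ord (e.2 some_label)).
Qed.

Lemma sum_le_max (I : finType) (p X : I -> R) (i0 : I) :
  (forall i, 0 <= p i) -> \sum_i p i <= 1 -> (forall i, 0 <= X i) ->
  exists i, \sum_j p j * X j <= X i.
Proof.
move=> p0 p1 X0; pose i := [arg max_(i > i0) X i]%O; exists i.
have Xi j : X j <= X i by rewrite /i; case: Order.TotalTheory.arg_maxP => // a _; apply.
apply: (@le_trans _ _ (\sum_j p j * X i)).
  by apply: ler_sum => j _; rewrite ler_wpM2l.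
by rewrite -mulr_suml ler_piMl.
Qed.

Lemma sum_by_fst (F : edge -> R) :
  \sum_(e <- E) F e = \sum_u \sum_(e <- E | e.1.1 == u) F e.
Proof. exact: (partition_big (fun e : edge => e.1.1) xpredT). Qed.

Lemma sum_by_snd (F : edge -> R) :
  \sum_(e <- E) F e = \sum_v \sum_(e <- E | e.1.2 == v) F e.
Proof. exact: (partition_big (fun e : edge => e.1.2) xpredT). Qed.

(** Rounding in two rounds, each replacing a distribution by its best label: first on V, where the
    edges split by their V-end, then on U. Total mass below 1 is allowed since all payoffs are
    nonnegative. *)
Lemma fractional_labeling (p : 'I_(lcV L) -> 'I_k -> R) (q : 'I_(lcU L) -> 'I_s -> R) :
  (forall v i, 0 <= p v i) -> (forall v, \sum_i p v i <= 1) ->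
  (forall u j, 0 <= q u j) -> (forall u, \sum_j q u j <= 1) ->
  \sum_(e <- E) \sum_i p e.1.2 i * q e.1.1 (e.2 i) <= Val R L * (size E)%:R.
Proof.
move=> p0 p1 q0 q1.
pose X v i := \sum_(e <- E | e.1.2 == v) q e.1.1 (e.2 i).
have X0 v i : 0 <= X v i by apply: sumr_ge0 => e _; exact: q0.
have [l2 l2P] := fin_all_exists (fun v => sum_le_max some_label (p0 v) (p1 v) (X0 v)).
pose Y u j : R := \sum_(e <- E | e.1.1 == u) (e.2 (l2 e.1.2) == j)%:R.
have Y0 u j : 0 <= Y u j by apply: sumr_ge0 => e _.
have [l1 l1P] := fin_all_exists
  (fun u => sum_le_max (Ordinal ord_s_nonempty) (q0 u) (q1 u) (Y0 u)).
apply: le_trans (count_le_Val ([ffun u => l1 u], [ffun v => l2 v])).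
apply: (@le_trans _ _ (\sum_(e <- E) q e.1.1 (e.2 (l2 e.1.2)))).
  rewrite [leLHS]sum_by_snd [leRHS]sum_by_snd; apply: ler_sum => v _.
  have -> : \sum_(e <- E | e.1.2 == v) q e.1.1 (e.2 (l2 e.1.2)) = X v (l2 v).
    by apply: eq_bigr => e /eqP ->.
  apply: le_trans (l2P v); rewrite /X.
  under [leRHS]eq_bigr do rewrite mulr_sumr.
  by rewrite [leRHS]exchange_big; apply: ler_sum => e /eqP ->.
have -> : (count (lc_sat ([ffun u => l1 u], [ffun v => l2 v])) E)%:R
    = \sum_(e <- E) (e.2 (l2 e.1.2) == l1 e.1.1)%:R :> R.
  rewrite -sum1_count natr_sum big_mkcond; apply: eq_bigr => e _.
  by rewrite /lc_sat /= !ffunE; case: eqP.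
rewrite [leLHS]sum_by_fst [leRHS]sum_by_fst; apply: ler_sum => u _.
have -> : \sum_(e <- E | e.1.1 == u) (e.2 (l2 e.1.2) == l1 e.1.1)%:R = Y u (l1 u).
  by apply: eq_bigr => e /eqP ->.
apply: le_trans (l1P u); rewrite /Y.
under [leRHS]eq_bigr do rewrite mulr_sumr.
rewrite [leRHS]exchange_big; apply: ler_sum => e /eqP -> /=.
rewrite (bigD1 (e.2 (l2 e.1.2))) //= eqxx mulr1 lerDl.
by apply: sumr_ge0 => j _; rewrite mulr_ge0.
Qed.

(** A fixed label on V and a uniform one on U satisfy each edge with probability 1 / s. *)
Lemma Val_ge_inv_alphabet : 1 <= Val R L * s%:R.
Proof.
have s0 : 0 < s%:R :> R by rewrite ltr0n ord_s_nonempty.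
have one (F : 'I_k -> R) : \sum_i (i == some_label)%:R * F i = F some_label.
  rewrite (bigD1 some_label) //= eqxx mul1r big1 ?addr0 // => i /negbTE ->.
  by rewrite mul0r.
have one1 (v : 'I_(lcV L)) : \sum_i (i == some_label)%:R <= 1 :> R.
  by rewrite (eq_bigr (fun i => (i == some_label)%:R * 1)) ?one // => i _; rewrite mulr1.
have inv0 (u : 'I_(lcU L)) (j : 'I_s) : 0 <= s%:R^-1 :> R by rewrite invr_ge0 ler0n.
have inv1 (u : 'I_(lcU L)) : \sum_(j < s) s%:R^-1 <= 1 :> R.
  by rewrite sumr_const card_ord -[_^-1 *+ _]mulr_natl divff // lt0r_neq0.
have le_V := @fractional_labeling (fun _ i => (i == some_label)%:R)
  (fun _ _ => s%:R^-1) (fun _ _ => ler0n _ _) one1 inv0 inv1.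
move: le_V; under eq_bigr do rewrite (one (fun=> _)).
rewrite big_const_seq count_predT iter_addr addr0 -[_^-1 *+ _]mulr_natr.
rewrite ler_pM2r ?edges_gt0 // => le_V.
by rewrite -ler_pdivrMr // mul1r.
Qed.

Lemma Val1_labeling : Val R L = 1 -> exists l : labeling L, all (lc_sat l) E.
Proof.
move=> V1; have := Val_max; rewrite V1 mul1r => /eqP; rewrite eqr_nat => /eqP Emax.
pose l0 : labeling L := ([ffun=> Ordinal ord_s_nonempty], [ffun=> some_label]).
have c0 : (0 < #|{: labeling L}|)%N by apply/card_gt0P; exists l0.
have [l El] := bigop.eq_bigmax (fun l : labeling L => count (lc_sat l) E) c0.
by exists l; rewrite all_count -El -Emax.
Qed.

(** Regularity only asserts that a degree exists; counting at the end of an actual edge names it and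
    makes it visibly positive. *)
Definition degU : nat := count (fun e : edge => e.1.1 == (xchoose some_edge).1.1) E.

Lemma count_degU u : count (fun e : edge => e.1.1 == u) E = degU.
Proof. by case: (lc_regU L) => d dP; rewrite /degU !dP. Qed.

Lemma degU_gt0 : (0 < degU)%N.
Proof.
rewrite /degU -has_count; apply/hasP; exists (xchoose some_edge) => //.
exact: xchooseP.
Qed.

Lemma size_degU : (size E = lcU L * degU)%N.
Proof.
rewrite -count_predT -sum1_count (partition_big (fun e : edge => e.1.1) xpredT) //=.
under eq_bigr do rewrite sum1_count count_degU.
by rewrite sum_nat_const card_ord.
Qed.

(** By regularity, the V-end of a uniform edge is a uniform vertex of V. *)
Lemma size_degV (F : 'I_(lcV L) -> R) :
  (lcV L)%:R * \sum_(e <- E) F e.1.2 = (size E)%:R * \sum_v F v.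
Proof.
have [d dP] := lc_regV L.
have -> : \sum_(e <- E) F e.1.2 = d%:R * \sum_v F v.
  rewrite sum_by_snd mulr_sumr; apply: eq_bigr => v _.
  rewrite (eq_bigr (fun=> F v)) => [|e /eqP -> //].
  by rewrite big_const_seq iter_addr addr0 dP mulr_natl.
have -> : (size E = lcV L * d)%N.
  rewrite -count_predT -sum1_count (partition_big (fun e : edge => e.1.2) xpredT) //=.
  under eq_bigr do rewrite sum1_count dP.
  by rewrite sum_nat_const card_ord.
by rewrite natrM mulrA.
Qed.

Lemma pair_count :
  \sum_(e <- E) \sum_(e' <- E | e'.1.1 == e.1.1) 1 = (size E)%:R * degU%:R :> R.
Proof.
under eq_bigr do rewrite big_const_seq iter_addr addr0 count_degU.
by rewrite big_const_seq count_predT iter_addr addr0 -[_ *+ size E]mulr_natl.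
Qed.

(** Label u by choosing a random edge at u and projecting a random label of its V-end. An edge e
    then agrees with u as often as e agrees with a random edge sharing u. *)
Lemma pair_decoding (p : 'I_(lcV L) -> 'I_k -> R) :
  (forall v i, 0 <= p v i) -> (forall v, \sum_i p v i <= 1) ->
  \sum_(e <- E) \sum_(e' <- E | e'.1.1 == e.1.1)
     \sum_i \sum_i' p e.1.2 i * p e'.1.2 i' * (e.2 i == e'.2 i')%:R
  <= degU%:R * (Val R L * (size E)%:R).
Proof.
move=> p0 p1.
have d0 : 0 < degU%:R :> R by rewrite ltr0n degU_gt0.
pose q u j : R := degU%:R^-1 * \sum_(e' <- E | e'.1.1 == u)
  \sum_i' p e'.1.2 i' * (j == e'.2 i')%:R.
have q0 u j : 0 <= q u j.
  rewrite mulr_ge0 ?invr_ge0 ?ler0n //.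
  by do 2! (apply: sumr_ge0 => ? _); rewrite mulr_ge0.
have q1 u : \sum_j q u j <= 1.
  rewrite -mulr_sumr exchange_big mulrC ler_pdivrMr // mul1r.
  rewrite -(count_degU u) -sum1_count natr_sum; apply: ler_sum => e _.
  apply: le_trans (p1 e.1.2); rewrite exchange_big; apply: ler_sum => i _ /=.
  rewrite (bigD1 (e.2 i)) //= eqxx mulr1 big1 ?addr0 // => j /negbTE ->.
  by rewrite mulr0.
have le_V := fractional_labeling p0 p1 q0 q1.
move: le_V; rewrite -(ler_pM2l d0); apply: le_trans; rewrite mulr_sumr.
apply: ler_sum => e _; rewrite mulr_sumr exchange_big; apply: ler_sum => i _ /=.
rewrite /q [leRHS]mulrCA mulVKf ?lt0r_neq0 // mulr_sumr.
by apply: ler_sum => e' _; rewrite mulr_sumr; apply: ler_sum => i' _; rewrite mulrA.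
Qed.

(* Jensen's inequality twice: for [a => a ^ 2] over the edges, and for
   [t => t ^ 2] over the sums around the vertices of U. *)
Lemma pair_energy (a : 'I_(lcV L) -> R) (t : R) : 0 <= t ->
  t * (size E)%:R <= \sum_(e <- E) a e.1.2 ->
  (size E)%:R * degU%:R * t ^+ 4
  <= \sum_(e <- E) \sum_(e' <- E | e'.1.1 == e.1.1) a e.1.2 ^+ 2 * a e'.1.2 ^+ 2.
Proof.
move=> t0 le_t.
pose Q u := \sum_(e <- E | e.1.1 == u) a e.1.2 ^+ 2.
have -> : \sum_(e <- E) \sum_(e' <- E | e'.1.1 == e.1.1) a e.1.2 ^+ 2 * a e'.1.2 ^+ 2
    = \sum_u Q u ^+ 2.
  rewrite sum_by_fst; apply: eq_bigr => u _; rewrite expr2 mulr_suml.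
  by apply: eq_bigr => e /eqP ->; rewrite mulr_sumr.
have S2 : t ^+ 2 * (size E)%:R <= \sum_u Q u.
  rewrite -sum_by_fst.
  apply: (@le_trans _ _ (\sum_(e <- E) (2 * t * a e.1.2 - t ^+ 2))); last first.
    apply: ler_sum => e _; rewrite -subr_ge0.
    have -> : a e.1.2 ^+ 2 - (2 * t * a e.1.2 - t ^+ 2) = (a e.1.2 - t) ^+ 2 by ring.
    exact: sqr_ge0.
  rewrite sumrB -mulr_sumr big_const_seq count_predT iter_addr addr0 -mulr_natr.
  have := ler_wpM2l t0 le_t; lra.
pose T := degU%:R * t ^+ 2.
apply: (@le_trans _ _ (\sum_u (2 * T * Q u - T ^+ 2))); last first.
  apply: ler_sum => u _; rewrite -subr_ge0.
  have -> : Q u ^+ 2 - (2 * T * Q u - T ^+ 2) = (Q u - T) ^+ 2 by ring.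
  exact: sqr_ge0.
rewrite sumrB -mulr_sumr sumr_const card_ord -[_ *+ lcU L]mulr_natl.
have T0 : 0 <= 2 * T by rewrite mulr_ge0 // mulr_ge0 // exprn_ge0.
have := ler_wpM2l T0 S2; rewrite size_degU natrM /T => H.
rewrite lerBrDr; apply: le_trans H.
by rewrite le_eqVlt; apply/orP; left; apply/eqP; ring.
Qed.

End LabelCover.

(** * Completeness and soundness *)

Section Assignments.

Variables (R : realType) (n : nat) (sigma : 'I_n -> 'F_2) (S : {set 'I_n}).

(** Defined on natural numbers, with value 0 out of range, so that it can be evaluated on raw
    equations. [sign_val] is (-1) ^ sigma on S and 0 elsewhere. *)
Definition mem_val (i : nat) : R := if insub i is Some j then (j \in S)%:R else 0.
Definition odd_val (i : nat) : bool := if insub i is Some j then sigma j != 0 else false.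
Definition sign_val (i : nat) : R := mem_val i * (-1) ^+ odd_val i.

Lemma F2_cases (x : 'F_2) : x = 0 \/ x = 1.
Proof. by case: x => [[|[|]]] // lt_x; [left | right]; apply: val_inj. Qed.

Lemma F2_neq0D (x y : 'F_2) : (x + y != 0) = (x != 0) (+) (y != 0).
Proof. by case: (F2_cases x) => ->; case: (F2_cases y) => ->. Qed.

Lemma F2_eq (x y : 'F_2) : (x == y) = ((x != 0) == (y != 0)).
Proof. by case: (F2_cases x) => ->; case: (F2_cases y) => ->. Qed.

Lemma prod_mem_val (t : seq 'I_n) :
  \prod_(i <- map val t) mem_val i = (all (fun i => i \in S) t)%:R.
Proof.
elim: t => [|i t IHt]; first by rewrite big_nil.
by rewrite /= big_cons IHt /mem_val valK; case: (i \in S); rewrite ?mul1r ?mul0r.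
Qed.

Lemma prod_sign_val (t : seq 'I_n) :
  \prod_(i <- map val t) sign_val i
  = (all (fun i => i \in S) t)%:R * (-1) ^+ (\sum_(i <- t) sigma i != 0).
Proof.
rewrite big_split /= prod_mem_val; congr (_ * _).
elim: t => [|i t IHt]; first by rewrite !big_nil eqxx.
by rewrite /= !big_cons IHt F2_neq0D signr_addb /odd_val valK.
Qed.

Lemma eqn_sign (e : lin_eqn n) :
  (-1) ^+ (untype e).2 * \prod_(i <- (untype e).1) sign_val i
  = (all (fun i => i \in S) e.1)%:R * (2 * (\sum_(i <- e.1) sigma i == e.2)%:R - 1) :> R.
Proof.
rewrite prod_sign_val mulrCA [_ == e.2]F2_eq; congr (_ * _).
have -> : (-1) ^+ (untype e).2 = (-1) ^+ (e.2 != 0) :> R.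
  by rewrite /untype /=; case: (F2_cases e.2) => ->.
move: (e.2 != 0) (\sum_(i <- e.1) sigma i != 0) => b a.
by case: a b => [] []; rewrite /= ?expr0 ?expr1; lra.
Qed.

Variables (l : seq (lin_eqn n)) (ul : all (fun e : lin_eqn n => uniq e.1) l).
Let H := Lin4 ul.

Lemma size_induced :
  (size (@lin_induced H S))%:R
  = \sum_(r <- map (@untype n) l) \prod_(i <- r.1) mem_val i :> R.
Proof.
rewrite /lin_induced size_filter -sum1_count natr_sum big_mkcond big_map.
by apply: eq_bigr => e _; rewrite prod_mem_val; case: (all _ _).
Qed.

(** An equation inside S contributes 1 if satisfied and -1 if not; all others contribute 0. *)
Lemma count_induced :
  2 * (count (@lin_sat H sigma) (@lin_induced H S))%:R - (size (@lin_induced H S))%:R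
  = \sum_(r <- map (@untype n) l) (-1) ^+ r.2 * \prod_(i <- r.1) sign_val i :> R.
Proof.
rewrite big_map (eq_bigr _ (fun e _ => eqn_sign e)) /lin_induced /= count_filter.
rewrite size_filter -!sum1_count !natr_sum !(big_mkcond (fun _ => _ && _)) /=.
rewrite [X in _ - X]big_mkcond [X in 2 * X]big_mkcond mulr_sumr -sumrB.
apply: eq_bigr => e _; rewrite /lin_sat /=.
by case: (all _ _); case: (_ == _) => /=; lra.
Qed.

End Assignments.

(** * Global sums of the test *)

Section TestSums.

Variables (R : realType) (m k s : nat) (L : label_cover k s).

Local Notation E := (lcE L).
Local Notation edge := (lc_edge (lcU L) (lcV L) k s).

Definition test_sum (V : nmodType) (T : edge -> edge -> cube k -> cube k -> bool ->
    cube s -> {ffun 'I_k -> 'I_m.+2} -> {ffun 'I_k -> 'I_m.+2} -> V) : V :=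
  \sum_(e <- E) \sum_(e' <- E | e'.1.1 == e.1.1)
  \sum_(x : cube k) \sum_(y : cube k) \sum_(b : bool) \sum_(z : cube s)
  \sum_(w : {ffun 'I_k -> 'I_m.+2}) \sum_(w' : {ffun 'I_k -> 'I_m.+2})
    T e e' x y b z w w'.

Lemma eq_test_sum (V : nmodType) T T' :
  (forall e e' x y b z w w', e \in E -> e' \in E -> e'.1.1 = e.1.1 ->
     T e e' x y b z w w' = T' e e' x y b z w w') ->
  @test_sum V T = test_sum T'.
Proof.
move=> TT'; rewrite /test_sum [LHS]big_seq [RHS]big_seq; apply: eq_bigr => e eE.
rewrite [LHS]big_seq_cond [RHS]big_seq_cond; apply: eq_bigr => e' /andP [eE' /eqP Eu].
by do 6! (apply: eq_bigr => ? _); apply: TT'.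
Qed.

Lemma test_sumD T T' : @test_sum R T + test_sum T'
  = test_sum (fun e e' x y b z w w' => T e e' x y b z w w' + T' e e' x y b z w w').
Proof.
rewrite /test_sum.
by do 8! (rewrite -big_split; apply: eq_bigr => ? _).
Qed.

Lemma ler_test_sum (T T' : edge -> edge -> cube k -> cube k -> bool ->
    cube s -> {ffun 'I_k -> 'I_m.+2} -> {ffun 'I_k -> 'I_m.+2} -> R) :
  (forall e e' x y b z w w', T e e' x y b z w w' <= T' e e' x y b z w w') ->
  test_sum T <= test_sum T'.
Proof. by move=> TT'; rewrite /test_sum; do 8! (apply: ler_sum => ? _). Qed.

(** The number of choices of (x, y, b, z, w, w') for one pair of edges. *)
Definition local_size : R := 2 * 2 ^+ s * ((2 ^+ k) ^+ 2 * (m.+2%:R ^+ k) ^+ 2).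

Lemma test_sum_const (c : R) :
  test_sum (fun _ _ _ _ _ _ _ _ => c) = (size E)%:R * (degU L)%:R * (local_size * c).
Proof.
rewrite -pair_count /test_sum.
have -> (d : R) : (\sum_(e <- E) \sum_(e' <- E | e'.1.1 == e.1.1) 1) * d
    = \sum_(e <- E) \sum_(e' <- E | e'.1.1 == e.1.1) d.
  rewrite mulr_suml; apply: eq_bigr => e _; rewrite mulr_suml.
  by apply: eq_bigr => e' _; rewrite mul1r.
apply: eq_bigr => e _; apply: eq_bigr => e' _.
rewrite !sumr_const !card_ffun card_bool !card_ord -!mulrnA /local_size.
rewrite -[c *+ _]mulr_natl !natrM !natrX; ring.
Qed.

Definition copies_sum (uq : bool) (T : 'I_s -> 'I_s -> 'I_s -> 'I_s -> R) : R :=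
  \sum_(c1 < s) \sum_(c2 < s) \sum_(c3 < s)
    \sum_(c4 < s | uq ==> uniq [:: c1; c2; c3; c4]) T c1 c2 c3 c4.

Lemma copies_sum_false T : copies_sum false T
  = \sum_(c1 < s) \sum_(c2 < s) \sum_(c3 < s) \sum_(c4 < s) T c1 c2 c3 c4.
Proof. by do 3! (apply: eq_bigr => ? _); apply: eq_bigl. Qed.

(** Union bound over the six pairs of copies; each pair coincides in s ^ 3 quadruples. *)
Lemma collision_count :
  copies_sum false (fun c1 c2 c3 c4 => (~~ uniq [:: c1; c2; c3; c4])%:R)
  <= 6 * s%:R ^+ 3.
Proof.
have sumc (c : R) : \sum_(i < s) c = s%:R * c by rewrite sumr_const card_ord mulr_natl.
have sumeq (j : 'I_s) : \sum_(i < s) (j == i)%:R = 1 :> R.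
  by rewrite (bigD1 j) //= eqxx big1 ?addr0 // => i /negbTE; rewrite eq_sym => ->.
apply: (@le_trans _ _ (\sum_(c1 < s) \sum_(c2 < s) \sum_(c3 < s) \sum_(c4 < s)
    ((c1 == c2)%:R + (c1 == c3)%:R + (c2 == c3)%:R + (c1 == c4)%:R
     + (c2 == c4)%:R + (c3 == c4)%:R))).
  do 4! (apply: ler_sum => ? _); rewrite /= !inE !negb_or.
  by do 6! case: (_ == _) => //=; lra.
rewrite le_eqVlt; apply/orP; left; apply/eqP.
transitivity (\sum_(c1 < s) \sum_(c2 < s) (s%:R ^+ 2 * (c1 == c2)%:R + 5 * s%:R) : R).
  apply: eq_bigr => c1 _; apply: eq_bigr => c2 _.
  transitivity (\sum_(c3 < s) (s%:R * ((c1 == c2)%:R + (c1 == c3)%:R + (c2 == c3)%:R) + 3) : R).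
    apply: eq_bigr => c3 _; rewrite !big_split /= !sumc !sumeq; ring.
  rewrite big_split /= -mulr_sumr !big_split /= !sumc !sumeq; ring.
transitivity (\sum_(c1 < s) (6 * s%:R ^+ 2) : R); last by rewrite sumc; ring.
apply: eq_bigr => c1 _; rewrite big_split /= -mulr_sumr sumeq sumc; ring.
Qed.

Lemma copies_sum_uniq T : (forall c1 c2 c3 c4, `|T c1 c2 c3 c4| <= 1) ->
  copies_sum true T <= copies_sum false T + 6 * s%:R ^+ 3
  /\ copies_sum false T <= copies_sum true T + 6 * s%:R ^+ 3.
Proof.
move=> T1.
have E0 : copies_sum true T = \sum_(c1 < s) \sum_(c2 < s) \sum_(c3 < s)
    \sum_(c4 < s) (if uniq [:: c1; c2; c3; c4] then T c1 c2 c3 c4 else 0).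
  by do 3! (apply: eq_bigr => ? _); rewrite [LHS]big_mkcond.
have step c1 c2 c3 c4 (u := uniq [:: c1; c2; c3; c4]) :
    (if u then T c1 c2 c3 c4 else 0) <= T c1 c2 c3 c4 + (~~ u)%:R
    /\ T c1 c2 c3 c4 <= (if u then T c1 c2 c3 c4 else 0) + (~~ u)%:R.
  have := T1 c1 c2 c3 c4; rewrite ler_norml => /andP [le1 le2].
  by case: u => /=; split; lra.
split; apply: le_trans (lerD (lexx _) collision_count); rewrite E0 !copies_sum_false.
  do 4! (rewrite -big_split; apply: ler_sum => ? _); exact: (step _ _ _ _).1.
by do 4! (rewrite -big_split; apply: ler_sum => ? _); exact: (step _ _ _ _).2.
Qed.

Definition test_term (eps : bool) (f : 'I_(lcV L) -> cube k -> 'I_s -> R)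
    (e e' : edge) x y b z (w w' : {ffun 'I_k -> 'I_m.+2}) c1 c2 c3 c4 : R :=
  (-1) ^+ (eps && b) * (f e.1.2 x c1 * f e.1.2 (shift e.2 x z w b) c2
    * (f e'.1.2 y c3 * f e'.1.2 (shift e'.2 y z w' false) c4)).

Definition full_test uq eps f : R :=
  test_sum (fun e e' x y b z w w' => copies_sum uq (test_term eps f e e' x y b z w w')).

(** A sum over copies; the normalisation by s is postponed to the powers of s in the bounds. *)
Definition avg (f : 'I_(lcV L) -> cube k -> 'I_s -> R) v x : R := \sum_c f v x c.

Lemma full_test_local eps f : full_test false eps f
  = \sum_(e <- E) \sum_(e' <- E | e'.1.1 == e.1.1)
      local_test m e.2 e'.2 eps (avg f e.1.2) (avg f e'.1.2).
Proof.
apply: eq_bigr => e _; apply: eq_bigr => e' _; rewrite /local_test.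
apply: eq_bigr => x _; apply: eq_bigr => y _; apply: eq_bigr => b _.
apply: eq_bigr => z _; apply: eq_bigr => w _; apply: eq_bigr => w' _.
rewrite copies_sum_false /test_term /avg -mulrA [X in _ * (X * _)]big_distrlr.
rewrite [X in _ * (_ * X)]big_distrlr /= mulr_suml mulr_sumr; apply: eq_bigr => c1 _.
rewrite mulr_suml mulr_sumr; apply: eq_bigr => c2 _.
rewrite mulr_sumr mulr_sumr; apply: eq_bigr => c3 _.
by rewrite mulr_sumr mulr_sumr.
Qed.

Lemma full_test_uniq eps f : (forall v x c, `|f v x c| <= 1) ->
  full_test true eps f <= full_test false eps f
    + (size E)%:R * (degU L)%:R * (local_size * (6 * s%:R ^+ 3))
  /\ full_test false eps f <= full_test true eps f
    + (size E)%:R * (degU L)%:R * (local_size * (6 * s%:R ^+ 3)).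
Proof.
move=> f1; rewrite -test_sum_const !test_sumD.
have T1 e e' x y b z w w' c1 c2 c3 c4 :
    `|test_term eps f e e' x y b z w w' c1 c2 c3 c4| <= 1.
  rewrite /test_term normrM normrX normrN1 expr1n mul1r !normrM.
  by rewrite !(mulr_ile1, mulr_ge0).
by split; apply: ler_test_sum => e e' x y b z w w'; case: (copies_sum_uniq (T1 e e' x y b z w w')).
Qed.

(** Each |[avg]| is at most s, so by Parseval the decoding weights have mass at most N = 2 ^ k s ^
    2. Dividing by N gives the fractional labels that [pair_decoding] needs. *)
Lemma full_test_upper f : (forall v x c, `|f v x c| <= 1) ->
  full_test false true f
  <= (size E)%:R * (degU L)%:R * (local_size * (s%:R ^+ 4 * (m.+2%:R ^+ 2 / 4) * Val R L)).
Proof.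
move=> f1.
have s0 : 0 < s%:R :> R by rewrite ltr0n (ord_s_nonempty L).
pose N : R := 2 ^+ k * s%:R ^+ 2.
have N0 : 0 < N by rewrite mulr_gt0 ?exprn_gt0.
pose p v i := decode (avg f v) i / N.
have avg_le v x : avg f v x ^+ 2 <= s%:R ^+ 2.
  rewrite -real_normK ?num_real // ler_sqr ?nnegrE //.
  apply: le_trans (ler_norm_sum _ _ _) _.
  apply: (@le_trans _ _ (\sum_(c < s) 1)); first by apply: ler_sum.
  by rewrite sumr_const card_ord.
have p0 v i : 0 <= p v i by rewrite divr_ge0 ?decode_ge0 // ltW.
have p1 v : \sum_i p v i <= 1.
  rewrite -mulr_suml ler_pdivrMr // mul1r; apply: le_trans (sum_decode _) _.
  apply: (@le_trans _ _ (\sum_(x : cube k) s%:R ^+ 2)); first by apply: ler_sum.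
  by rewrite sumr_const card_ffun card_bool card_ord -[_ *+ (2 ^ k)%N]mulr_natl natrX.
pose Q : R := 2 * 2 ^+ s * (m.+2%:R ^+ k * (m.+2%:R / 2)) ^+ 2.
have Q0 : 0 <= Q.
  by do ?[apply: mulr_ge0 | apply: exprn_ge0]; rewrite ?invr_ge0 ?ler0n.
rewrite full_test_local.
apply: (@le_trans _ _ (Q * N ^+ 2 * ((degU L)%:R * (Val R L * (size E)%:R)))); last first.
  by rewrite le_eqVlt; apply/orP; left; apply/eqP; rewrite /Q /N /local_size; field.
have QN0 : 0 <= Q * N ^+ 2 by apply: mulr_ge0 Q0 _; rewrite exprn_ge0 ?ltW.
apply: le_trans (ler_wpM2l QN0 (pair_decoding p0 p1)).
rewrite mulr_sumr; apply: ler_sum => e _; rewrite mulr_sumr; apply: ler_sum => e' _.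
apply: le_trans (local_test_upper _ _ _ _ _) _; rewrite -/Q -[leRHS]mulrA; apply: (ler_wpM2l Q0).
rewrite mulr_sumr; apply: ler_sum => i _; rewrite mulr_sumr; apply: ler_sum => i' _.
rewrite /p le_eqVlt; apply/orP; left; apply/eqP; field; exact: lt0r_neq0.
Qed.

(** At the empty frequency the energy is the squared mass of the cloud over 2 ^ k. [pair_energy]
    bounds the sum of these products by the average mass. *)
Lemma full_test_lower g (t : R) : 0 <= t ->
  t * (lcV L)%:R * (2 ^+ k * s%:R) <= \sum_v \sum_x avg g v x ->
  (size E)%:R * (degU L)%:R * (local_size * (s%:R ^+ 4 * t ^+ 4))
  <= full_test false false g.
Proof.
move=> t0 le_t; pose a v := \sum_x avg g v x.
have aE v : energy (avg g v) (cube0 k) = a v ^+ 2 / 2 ^+ k.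
  by rewrite /energy /hat; under eq_bigr do rewrite chi_cube0l mulr1.
have [e0 _] := some_edge L.
have nV0 : 0 < (lcV L)%:R :> R by rewrite ltr0n; apply: leq_trans (ltn_ord e0.1.2).
pose tau := t * (2 ^+ k * s%:R).
have tau0 : 0 <= tau by rewrite !mulr_ge0 ?exprn_ge0.
have le_tau : tau * (size E)%:R <= \sum_(e <- E) a e.1.2.
  rewrite -(ler_pM2l nV0) size_degV mulrA [leRHS]mulrC ler_wpM2r //.
  apply: le_trans le_t; rewrite /tau le_eqVlt; apply/orP; left; apply/eqP; ring.
have := pair_energy tau0 le_tau.
rewrite full_test_local => le_E.
pose Q : R := 2 * 2 ^+ s * (m.+2%:R ^+ k) ^+ 2 / (2 ^+ k) ^+ 2.
have k0 : 2 ^+ k != 0 :> R by rewrite expf_neq0 // pnatr_eq0.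
have Q0 : 0 <= Q.
  by do ?[apply: mulr_ge0 | apply: exprn_ge0]; rewrite ?invr_ge0 ?exprn_ge0 ?ler0n.
apply: (@le_trans _ _ (Q * ((size E)%:R * (degU L)%:R * tau ^+ 4))).
  by rewrite le_eqVlt; apply/orP; left; apply/eqP; rewrite /Q /tau /local_size; field.
apply: le_trans (ler_wpM2l Q0 le_E) _.
rewrite mulr_sumr; apply: ler_sum => e _; rewrite mulr_sumr; apply: ler_sum => e' _.
apply: le_trans (local_test_lower _ _ _ _ _); rewrite !aE /Q.
by rewrite le_eqVlt; apply/orP; left; apply/eqP; field.
Qed.

End TestSums.

Lemma full_test_raw (R : realType) m k s (L : label_cover k s) (eps : bool) (h : nat -> R) :
  \sum_(r <- raw_eqns m.+2 L) (-1) ^+ (eps * r.2) * \prod_(i <- r.1) h i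
  = full_test m true eps (fun v x c => h (@var (lcV L) k s v x c)).
Proof.
rewrite big_raw_eqns; do 11! (apply: eq_bigr => ? _); apply: eq_bigr => c4 _.
rewrite /req /test_term /= !big_cons big_nil mulr1 -!mulrA mulnb.
by [].
Qed.

Lemma norm_mem_sign (R : realType) n sigma (S : {set 'I_n}) i :
  `|mem_val R S i| <= 1 /\ `|sign_val R sigma S i| <= 1.
Proof.
rewrite /sign_val normrM normrX normrN1 expr1n mulr1 /mem_val.
by case: insub => [j|]; rewrite ?normr0 //; case: (j \in S); rewrite ?normr1 ?normr0.
Qed.

Lemma sum_mem_val (R : realType) k s (L : label_cover k s)
    (S : {set 'I_(2 ^ k * s * lcV L)}) :
  \sum_v \sum_x avg (fun v x c => mem_val R S (@var (lcV L) k s v x c)) v x = #|S|%:R.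
Proof.
pose idv (t : 'I_(lcV L) * cube k * 'I_s) : 'I_(2 ^ k * s * lcV L) :=
  Ordinal (var_lt t.1.1 t.1.2 t.2).
have inj : injective idv.
  move=> [[v x] c] [[v' x'] c'] /(congr1 val) /= Evar.
  by have [-> -> ->] := var_inj Evar.
have bij : bijective idv.
  apply: inj_card_bij => //.
  by rewrite !card_prod !card_ord card_ffun card_bool card_ord; lia.
rewrite -sum1_card natr_sum [RHS]big_mkcond [RHS](reindex idv) /=; last exact: onW_bij.
transitivity (\sum_(t : 'I_(lcV L) * cube k) \sum_(c < s) mem_val R S (var t.1 t.2 c)).
  by rewrite pair_bigA.
rewrite pair_bigA /=.
apply: eq_bigr => t _; rewrite /mem_val.
by rewrite (insubT (fun i => i < _)%N (var_lt t.1.1 t.1.2 t.2)) -/(idv t); case: (idv t \in S).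
Qed.

(** The bias of the signed test is at least 2 nu times the unsigned test. The latter is bounded
    below by density, the former above by [Val]; the collision errors are absorbed by
    [Val_ge_inv_alphabet]. *)
Lemma soundness (R : realType) m k s (L : label_cover k s) (alpha nu : R)
    (l : seq (lin_eqn (2 ^ k * s * lcV L)))
    (ul : all (fun e : lin_eqn (2 ^ k * s * lcV L) => uniq e.1) l)
    (S : {set 'I_(2 ^ k * s * lcV L)}) sigma :
  map (@untype _) l = raw_eqns m.+2 L ->
  0 <= alpha -> 0 <= nu <= 1 ->
  alpha * (2 ^ k * s * lcV L)%:R <= #|S|%:R ->
  (1 / 2 + nu) * (size (@lin_induced (Lin4 ul) S))%:R
    <= (count (@lin_sat (Lin4 ul) sigma) (@lin_induced (Lin4 ul) S))%:R ->
  2 * nu * alpha ^+ 4 <= Val R L * (m.+2%:R ^+ 2 / 4 + 18).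
Proof.
move=> El a0 /andP [nu0 nu1] leS.
have := count_induced R sigma S ul; have := size_induced R S ul.
rewrite El => Es Ec le_count.
have Et : full_test m true true (fun v x c => sign_val R sigma S (@var (lcV L) k s v x c))
    = 2 * (count (@lin_sat (Lin4 ul) sigma) (@lin_induced (Lin4 ul) S))%:R
      - (size (@lin_induced (Lin4 ul) S))%:R.
  by rewrite Ec -full_test_raw; apply: eq_bigr => r _; rewrite mul1n.
have Ef : full_test m true false (fun v x c => mem_val R S (@var (lcV L) k s v x c))
    = (size (@lin_induced (Lin4 ul) S))%:R.
  by rewrite Es -full_test_raw; apply: eq_bigr => r _; rewrite mul0n expr0 mul1r.
move: Et Ef; set f := fun v x c => sign_val _ _ _ _; set g := fun v x c => mem_val _ _ _.
move=> Et Ef.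
have f1 v x c : `|f v x c| <= 1 by case: (norm_mem_sign R sigma S (var v x c)).
have g1 v x c : `|g v x c| <= 1 by case: (norm_mem_sign R sigma S (var v x c)).
have [le1 _] := full_test_uniq m true f1; have [_ le2] := full_test_uniq m false g1.
have le3 := full_test_upper m f1.
have le4 := @full_test_lower R m k s L g alpha a0.
have := sum_mem_val R S; rewrite -/g => Eg.
have {}le4 : (size (lcE L))%:R * (degU L)%:R
    * (local_size R m k s * (s%:R ^+ 4 * alpha ^+ 4)) <= full_test m false false g.
  apply: le4; rewrite Eg; apply: le_trans leS.
  by rewrite !natrM natrX le_eqVlt; apply/orP; left; apply/eqP; ring.
have s0 : 0 < s%:R :> R by rewrite ltr0n (ord_s_nonempty L).
(* The common scale: s ^ 3 times the number of choices other than copies. Restricting either test to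
   distinct copies changes it by at most 6 K. *)
pose K : R := (size (lcE L))%:R * (degU L)%:R * (local_size R m k s * s%:R ^+ 3).
have K0 : 0 < K.
  rewrite /K /local_size; do ?[apply: mulr_gt0 | apply: exprn_gt0] => //;
    by rewrite ?edges_gt0 ?ltr0n ?degU_gt0.
have Vs := Val_ge_inv_alphabet R L.
rewrite -(ler_pM2l K0) -(ler_pM2l s0).
set D := _ * (_ * (6 * _)) in le1 le2.
have ED : D = 6 * K by rewrite /D /K; ring.
have le5 : 2 * nu * full_test m true false g <= full_test m true true f by rewrite Et Ef; lra.
have le6 : 2 * nu * full_test m false false g
    <= full_test m false true f + (1 + 2 * nu) * (6 * K).
  have nu2 : 0 <= 2 * nu by lra.
  by have := ler_wpM2l nu2 le2; rewrite ED in le1 *; lra.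
have le7 : 2 * nu * (K * (s%:R * alpha ^+ 4))
    <= K * (s%:R * (m.+2%:R ^+ 2 / 4) * Val R L) + 18 * K.
  have nu2 : 0 <= 2 * nu by lra.
  have le8 : (1 + 2 * nu) * (6 * K) <= 18 * K.
    rewrite mulrA; apply: ler_wpM2r; [exact: ltW | lra].
  have E3 : (size (lcE L))%:R * (degU L)%:R
    * (local_size R m k s * (s%:R ^+ 4 * (m.+2%:R ^+ 2 / 4) * Val R L))
    = K * (s%:R * (m.+2%:R ^+ 2 / 4) * Val R L) by rewrite /K; ring.
  have E4 : (size (lcE L))%:R * (degU L)%:R
    * (local_size R m k s * (s%:R ^+ 4 * alpha ^+ 4)) = K * (s%:R * alpha ^+ 4).
    by rewrite /K; ring.
  rewrite E3 in le3; rewrite E4 in le4.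
  by have := ler_wpM2l nu2 le4; lra.
(* The collision error lacks one factor s compared with the main terms; [Val] times s being at least
   1 restores it. *)
have le9 : 18 * K <= 18 * K * (Val R L * s%:R).
  by rewrite -{1}[18 * K]mulr1 ler_wpM2l // mulr_ge0 // ltW.
have E5 : s%:R * (K * (2 * nu * alpha ^+ 4)) = 2 * nu * (K * (s%:R * alpha ^+ 4)) by ring.
have E6 : s%:R * (K * (Val R L * (m.+2%:R ^+ 2 / 4 + 18)))
  = K * (s%:R * (m.+2%:R ^+ 2 / 4) * Val R L) + 18 * K * (Val R L * s%:R) by ring.
by rewrite E5 E6; lra.
Qed.

Definition flip (R : realType) k m (i : 'I_k) (w : {ffun 'I_k -> 'I_m.+2}) : R :=
  (-1) ^+ (w i == ord0).

(** This is the noise sum at the singleton frequency i. *)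
Lemma sum_flip (R : realType) k m (i : 'I_k) :
  \sum_w flip R (m := m) i w = m.+2%:R ^+ k * (m%:R / m.+2%:R) :> R.
Proof.
pose d : cube k := [ffun j => j == i].
have wt1 : wt d = 1%N.
  rewrite /wt; have -> : [set j | d j] = [set i]; last by rewrite cards1.
  by apply/setP => j; rewrite !inE ffunE.
rewrite -[_ / _]expr1 -wt1 -noise_sumE; apply: eq_bigr => w _.
rewrite /chi (bigD1 i) //= big1 => [|j /negbTE ne]; last by rewrite !ffunE ne.
by rewrite !ffunE eqxx mulr1.
Qed.

Lemma completeness (R : realType) m k s (L : label_cover k s)
    (l : seq (lin_eqn (2 ^ k * s * lcV L)))
    (ul : all (fun e : lin_eqn (2 ^ k * s * lcV L) => uniq e.1) l) :
  map (@untype _) l = raw_eqns m.+2 L -> Val R L = 1 ->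
  exists sigma : 'I_(2 ^ k * s * lcV L) -> 'F_2,
    (1 - 2 / m.+2%:R) * (size l)%:R <= (count (@lin_sat (Lin4 ul) sigma) l)%:R :> R.
Proof.
move=> El /Val1_labeling [lab /allP labP].
(* The dictator assignment: the variable coding (v, x, c) gets the bit of x at the label of v.
   Injectivity of [var] ensures that the picked triple is the intended one. *)
pose sigma (j : 'I_(2 ^ k * s * lcV L)) : 'F_2 :=
  if [pick t : 'I_(lcV L) * cube k * 'I_s | var t.1.1 t.1.2 t.2 == j] is Some t
  then if t.1.2 (lab.2 t.1.1) then 1 else 0 else 0.
exists sigma.
have sgn v x c : sign_val R sigma setT (@var (lcV L) k s v x c) = (-1) ^+ x (lab.2 v).
  rewrite /sign_val /mem_val /odd_val.
  rewrite (insubT (fun i => i < _)%N (var_lt v x c)) /= inE mul1r /sigma.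
  case: pickP => [[[v' x'] c'] /= /eqP Evar | /(_ (v, x, c))]; last by rewrite /= eqxx.
  by have [-> -> _] := var_inj Evar; case: (x _).
have mem1 v x c : mem_val R [set: 'I_(2 ^ k * s * lcV L)] (@var (lcV L) k s v x c) = 1.
  by rewrite /mem_val (insubT (fun i => i < _)%N (var_lt v x c)) /= inE.
have Eall : @lin_induced (Lin4 ul) setT = l.
  rewrite /lin_induced /=; apply/all_filterP/allP => e _.
  by apply/allP => i _; rewrite inE.
have := count_induced R sigma setT ul; have := size_induced R setT ul.
rewrite Eall El => Es Ec.
pose Cs : R := copies_sum true (fun _ _ _ _ : 'I_s => 1).
have {}Es : (size l)%:R = (size (lcE L))%:R * (degU L)%:R * (local_size R m k s * Cs).
  rewrite Es -test_sum_const; transitivity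
    (full_test m true false (fun v x c =>
      mem_val R [set: 'I_(2 ^ k * s * lcV L)] (@var (lcV L) k s v x c))).
    by rewrite -full_test_raw; apply: eq_bigr => r _; rewrite mul0n expr0 mul1r.
  apply: eq_test_sum => e e' x y b z w w' _ _ _.
  do 3! (apply: eq_bigr => ? _); apply: eq_bigr => c4 _.
  by rewrite /test_term !mem1 !mulr1.
pose rho : R := m%:R / m.+2%:R.
have {}Ec : 2 * (count (@lin_sat (Lin4 ul) sigma) l)%:R - (size l)%:R
    = (size (lcE L))%:R * (degU L)%:R * (local_size R m k s * (rho ^+ 2 * Cs)).
  rewrite Ec -test_sum_const; transitivity
    (full_test m true true (fun v x c => sign_val R sigma setT (@var (lcV L) k s v x c))).
    by rewrite -full_test_raw; apply: eq_bigr => r _; rewrite mul1n.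
  transitivity (test_sum (L := L) (fun e e' x y b z w w' =>
      flip R (m := m) (lab.2 e.1.2) w * flip R (lab.2 e'.1.2) w' * Cs)).
    apply: eq_test_sum => e e' x y b z w w' eE eE' Eu.
    rewrite /Cs /copies_sum !mulr_sumr; do 3! (apply: eq_bigr => ? _; rewrite ?mulr_sumr).
    apply: eq_bigr => c4 _; rewrite /test_term !sgn !ffunE mulr1 -!signr_addb /flip.
    (* Both edges are satisfied and share u, so both read z at the label of u. The bits of x, y, z
       and b cancel, which leaves the two noise flips. *)
    have := labP _ eE; have := labP _ eE'; rewrite /lc_sat Eu => /eqP -> /eqP ->.
    congr (_ ^+ _).
    by case: b; case: (x _); case: (y _); case: (z _); case: (w _ == _); case: (w' _ == _).
  do 6! (apply: eq_bigr => ? _).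
  have sumw (c : R) : \sum_(w : {ffun 'I_k -> 'I_m.+2}) c = m.+2%:R ^+ k * c.
    by rewrite sumr_const card_ffun !card_ord -[_ *+ (_ ^ _)%N]mulr_natl natrX.
  rewrite !sumw.
  under eq_bigr do rewrite -mulr_suml -mulr_sumr sum_flip.
  rewrite -mulr_suml -mulr_suml sum_flip -/rho; ring.
have Erho : rho = 1 - 2 / m.+2%:R.
  have mE : m%:R = m.+2%:R - 2 :> R by rewrite -addn2 natrD addrK.
  by rewrite /rho {1}mE mulrBl divff // pnatr_eq0.
have {}Ec : 2 * (count (@lin_sat (Lin4 ul) sigma) l)%:R - (size l)%:R
    = rho ^+ 2 * (size l)%:R :> R by rewrite Ec Es; ring.
set d : R := 2 / _ in Erho *.
have n0 : 0 <= (size l)%:R :> R by [].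
have d2 : 0 <= d ^+ 2 * (size l)%:R by rewrite mulr_ge0 ?sqr_ge0.
(* The satisfied fraction is (1 + rho ^ 2) / 2 = 1 - d + d ^ 2 / 2, at least 1 - d. *)
have E2 : rho ^+ 2 * (size l)%:R
    = (size l)%:R - 2 * (d * (size l)%:R) + d ^+ 2 * (size l)%:R by rewrite Erho; ring.
by rewrite mulrBl mul1r; lra.
Qed.

Theorem theorem7p3 (R : realType) :
  exists2 c : R, 0 < c &
  forall eta : R, 0 < eta < 1 ->
  exists2 P : expr, efficient P &
  forall (k s : nat) (L : label_cover k s),
  exists2 H : lin4, outputs P L H &
    (Val R L = 1 ->
       exists sigma : 'I_(lin_nvar H) -> 'F_2,
         (1 - 2 * eta) * (size (lin_eqs H))%:R
           <= (count (lin_sat sigma) (lin_eqs H))%:R)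
    /\
    (forall alpha nu : R, 0 < alpha < 1 -> 0 < nu < 1 ->
       (exists (S : {set 'I_(lin_nvar H)}) (sigma : 'I_(lin_nvar H) -> 'F_2),
          alpha * (lin_nvar H)%:R <= #|S|%:R
          /\ (1 / 2 + nu) * (size (lin_induced S))%:R
               <= (count (lin_sat sigma) (lin_induced S))%:R) ->
       c * (nu * alpha ^+ 16 * eta ^+ 2) <= Val R L).
Proof.
(* The 2 comes from the bias 2 nu; 21 rounds up 9 / 4 + 18, the bound on (q ^ 2 / 4 + 18) eta ^ 2
   given eta q <= 3 and eta <= 1. *)
exists (2 / 21) => [|eta /andP [eta0 eta1]]; first lra.
(* With q = m + 2 this gives 1 <= eta q <= 3: the left inequality turns the loss 2 / q into at most
   2 eta, the right one serves soundness. *)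
pose m := Num.trunc (eta^-1).
have etaV0 : 0 < eta^-1 by rewrite invr_gt0.
have /andP [m_le lt_m] : m%:R <= eta^-1 < m.+1%:R by apply: truncn_itv; exact: ltW.
pose q : R := m.+2%:R.
have q0 : 0 < q by rewrite ltr0n.
have qE : q = m.+1%:R + 1 by rewrite /q natr1.
have qE' : q = m%:R + 2 by rewrite /q -addn2 natrD.
have eta_q : 1 <= eta * q.
  by rewrite mulrC -ler_pdivrMr // mul1r; lra.
have q_eta : eta * q <= 3.
  have : eta * q <= eta * (eta^-1 + 2) by apply: ler_wpM2l; [exact: ltW | lra].
  by rewrite [eta * (_ + 2)]mulrDr divff ?lt0r_neq0 //; lra.
exists (reduction m.+2); first exact: efficient_reduction.
move=> k s L.
have [l [ul [El Henc]]] := lin4_of_raw (valid_raw_eqns m L).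
exists (Lin4 ul); first by rewrite /outputs Henc; exact: eval_reduction.
split=> [V1|alpha nu /andP [al0 al1] /andP [nu0 nu1] [S [sigma [leS le_count]]]].
  have [sigma Hs] := completeness ul El V1; exists sigma; apply: le_trans Hs.
  apply: ler_wpM2r => //; rewrite lerD2l lerN2 ler_pdivrMr // -mulrA.
  by rewrite -/q; lra.
have nu01 : 0 <= nu <= 1 by rewrite !ltW.
have sound := soundness El (ltW al0) nu01 leS le_count.
have V0 : 0 <= Val R L by rewrite divr_ge0.
(* The analysis yields alpha ^ 4, which is stronger because alpha < 1. *)
have le_al : alpha ^+ 16 <= alpha ^+ 4 by rewrite ler_wiXn2l // ltW.
have e2 : 0 <= eta ^+ 2 by exact: sqr_ge0.
have s1 := ler_wpM2r e2 sound.
have s2 : nu * alpha ^+ 16 * eta ^+ 2 <= nu * alpha ^+ 4 * eta ^+ 2.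
  by apply: ler_wpM2r => //; apply: ler_wpM2l => //; exact: ltW.
have s3 : (q ^+ 2 / 4 + 18) * eta ^+ 2 <= 21.
  have -> : (q ^+ 2 / 4 + 18) * eta ^+ 2 = (eta * q) ^+ 2 / 4 + 18 * eta ^+ 2 by field.
  have : (eta * q) ^+ 2 <= 3 ^+ 2 by rewrite ler_sqr ?nnegrE // mulr_ge0 // ltW.
  have : eta ^+ 2 <= 1 ^+ 2 by rewrite ler_sqr ?nnegrE // ltW.
  by lra.
have s4 := ler_wpM2l V0 s3.
rewrite -/q in s1 *.
have E1 : 2 * nu * alpha ^+ 4 * eta ^+ 2 = 2 * (nu * alpha ^+ 4 * eta ^+ 2) by ring.
have E2 : Val R L * (q ^+ 2 / 4 + 18) * eta ^+ 2 = Val R L * ((q ^+ 2 / 4 + 18) * eta ^+ 2).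
  by rewrite mulrA.
by rewrite E1 E2 in s1; lra.
Qed.
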